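(* There exist constants $C_2>0$ and $C>0$ such that for all sufficiently large $n$ and every integer $m\ge D(n,2)$, independent uniform $\boldsymbol{s}^{(1)},\ldots,\boldsymbol{s}^{(n)}\in\{\pm1\}^m$ satisfy $$\mathbb{P}\left[\operatorname{conv}\{\boldsymbol{s}^{(i)}(\boldsymbol{s}^{(i)})^\top:1\le i\le n\}\text{ is an exposed simplicial face of }\mathcal{E}_m\text{ of dimension }n-1\right]\ \ge\ 1-C_2\frac{(\log n)^{C}}{\sqrt n}.$$ Moreover, every face of $\mathcal{E}_m$ obtained this way (i.e. whenever the event in the probability holds, the set $\operatorname{conv}\{\boldsymbol{s}^{(i)}(\boldsymbol{s}^{(i)})^\top\}_{i=1}^n$) is also a face of $\mathcal{C}_m$.
   Context: $D(n,2)=1+\binom n2$. The elliptope is $\mathcal{E}_m=\{H\in\mathbb{R}^{m\times m}: H=H^\top\succeq0,\ \operatorname{diag}H=\mathbf{1}_m\}$ (real symmetric positive semidefinite matrices with all diagonal entries equal to $1$), and the cut polytope is $\mathcal{C}_m=\operatorname{conv}\{ss^\top:s\in\{\pm1\}^m\}\subseteq\mathcal{E}_m$. An exposed face of a convex set is the set of points of it minimizing a linear functional; it is simplicial when its vertices are affinely independent. The constants do not depend on $n,m$. *)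

(* Defs.v *)
From HB Require Import structures.
From mathcomp Require Import all_boot all_order all_algebra.
From mathcomp Require Import all_classical all_reals all_analysis.

Set Implicit Arguments.
Unset Strict Implicit.
Unset Printing Implicit Defensive.

Import Order.TTheory GRing.Theory Num.Theory.

Local Open Scope classical_set_scope.
Local Open Scope ring_scope.

Definition convex_hull (R : realType) (V : lmodType R) (A : set V) : set V :=
  [set x | exists (k : nat) (p : 'I_k -> V) (a : 'I_k -> R),
     [/\ forall i, A (p i), forall i, 0 <= a i, \sum_i a i = 1
       & x = \sum_i a i *: p i]].

(* The zero functional is allowed, so K is an exposed face of itself. *)
Definition exposed_face (R : realType) (V : lmodType R) (K F : set V) : Prop :=
  exists f : {scalar V}, F = [set x | K x /\ forall y, K y -> f x <= f y].

(* The vertices of a polytope are its extreme points. *)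
Definition vertices (R : realType) (V : lmodType R) (F : set V) : set V :=
  [set x | F x /\ forall y z (t : R), F y -> F z -> 0 < t -> t < 1 ->
     x = t *: y + (1 - t) *: z -> y = x /\ z = x].

Definition affinely_independent (R : realType) (V : lmodType R) (A : set V) :
    Prop :=
  forall (k : nat) (p : 'I_k -> V) (a : 'I_k -> R),
    injective p -> (forall i, A (p i)) ->
    \sum_i a i = 0 -> \sum_i a i *: p i = 0 -> forall i, a i = 0.

Definition simplicial (R : realType) (V : lmodType R) (F : set V) : Prop :=
  affinely_independent (vertices F).

(* The dimension of F is that of its affine hull, whose direction is the
   smallest linear subspace U containing all differences of points of F. *)
Definition has_affine_dim (R : realType) (V : vectType R) (F : set V) (d : nat) :
    Prop :=
  F !=set0 /\
  exists U : {vspace V},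
    [/\ forall x y, F x -> F y -> x - y \in U,
        forall W : {vspace V},
          (forall x y, F x -> F y -> x - y \in W) -> (U <= W)%VS
      & \dim U = d].

Definition pos_semidef (R : realType) (m : nat) (H : 'M[R]_m) : Prop :=
  H^T = H /\ forall x : 'cV[R]_m, 0 <= (x^T *m H *m x) 0 0.

Definition elliptope (R : realType) (m : nat) : set 'M[R]_m :=
  [set H | pos_semidef H /\ forall i, H i i = 1].
Arguments elliptope R m : clear implicits.

Definition sign_vector (R : realType) (m : nat) (s : 'cV[R]_m) : Prop :=
  forall j, s j 0 = 1 \/ s j 0 = -1.

Definition cut_polytope (R : realType) (m : nat) : set 'M[R]_m :=
  convex_hull [set s *m s^T | s in @sign_vector R m].
Arguments cut_polytope R m : clear implicits.

Definition cut_hull (R : realType) (n m : nat) (s : 'I_n -> 'cV[R]_m) :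
    set 'M[R]_m :=
  convex_hull (range (fun i => s i *m (s i)^T)).

Definition spans_simplicial_face (R : realType) (n m : nat)
    (s : 'I_n -> 'cV[R]_m) : Prop :=
  [/\ exposed_face (elliptope R m) (cut_hull s), simplicial (cut_hull s)
    & has_affine_dim (cut_hull s) n.-1].

Definition mutually_independent d (T : measurableType d) (R : realType)
    (P : probability T R) (n : nat) (U : Type) (X : 'I_n -> T -> U) : Prop :=
  forall (J : {set 'I_n}) (A : 'I_n -> set U),
    P (\bigcap_(i in [set` J]) (X i @^-1` A i)) =
    (\prod_(i in J) P (X i @^-1` A i))%E.

(* The s i take finitely many values, so these carry the discrete
   sigma-algebra: all preimages are measurable, and independence is tested on
   arbitrary sets of values. *)
Definition iid_uniform_signs d (T : measurableType d) (R : realType)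
    (P : probability T R) (n m : nat) (s : 'I_n -> T -> 'cV[R]_m) : Prop :=
  [/\ forall i w, sign_vector (s i w),
      forall i (A : set 'cV[R]_m), measurable (s i @^-1` A),
      forall i (v : 'cV[R]_m), sign_vector v ->
        P (s i @^-1` [set v]) = (2 ^- m)%:E
    & mutually_independent P s].

(* Main.v *)
Require Import Defs.
From HB Require Import structures.
From mathcomp Require Import all_boot all_order all_algebra.
From mathcomp Require Import cyclotomic algC.
From mathcomp Require Import all_classical all_reals all_analysis.
From mathcomp Require Import zify ring lra.

Set Implicit Arguments.
Unset Strict Implicit.
Unset Printing Implicit Defensive.

Import Order.TTheory GRing.Theory Num.Theory.

Local Open Scope ring_scope.

(** Arrange the sign vectors as the columns of an m x n matrix S and call its
    rows x_1, ..., x_m, which are points of {-1, 1}^n.  Everything hinges on one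
    condition: no nonzero quadric c + sum_(i < j) a_ij x_i x_j vanishes at all
    the rows.  We then say that the rows are in general position.

    General position forces the face (general_position_face).  It makes S
    injective, because a linear relation multiplied by a coordinate is a
    quadratic one.  The elements H of the elliptope whose range lies in that of
    S have the form S Y S^T with Y positive semidefinite, and form an exposed
    face.  The unit diagonal of H says that x_j^T Y x_j = 1 for every j; general
    position leaves only diagonal Y of trace 1, so H is a convex combination of
    the matrices s_i s_i^T, which are moreover linearly independent.

    It remains to bound the probability that some nonzero quadric vanishes at
    m >= N = 1 + n(n-1)/2 independent uniform points.  It suffices to do this
    modulo a prime p (general_position_lift), where there are finitely many
    quadrics.  If one of them vanishes on the array, so do its p - 1 nonzero
    multiples; hence (p - 1) P(degenerate) is at most the sum over q <> 0 of
    P(q(x) = 0)^m (card_degenerate).  If every probability were 1/p, the p^N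
    terms would add up to at most 1, whence a bound O(1/p).  Two facts make this
    heuristic correct (degenerate_le):
    - if the coefficient matrix of q has a large rank across some bipartition of
      the coordinates, then q(x) is almost exactly uniform modulo p.  This is a
      character sum estimate: Cauchy-Schwarz across the bipartition
      (expsum_decouple) leaves products of cosines indexed by pairs (y, y'),
      which are tiny unless the image of y - y' under the matrix is sparse, and
      this is rare when the rank is large (card_sparse_image);
    - if the rank is small across each of the log n bipartitions given by the
      binary digits of the indices, then q is determined by few low-rank
      matrices, so there are only exp(o(n^2)) such q (card_low_rank), while each
      has P(q(x) = 0) <= 3/4 (card_nonzero).

    A product of n cosines of multiples of 2 pi / p can be as large as
    exp(- O(n / p^2)).  Hence p has to be smaller than sqrt n by a power of
    log n, and this is the source of the rate (log n)^C / sqrt n.  Such a prime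
    exists by the classical estimate on the central binomial coefficient
    (prime_between).

    The face is also a face of the cut polytope, exposed by the same functional,
    since the cut polytope lies between the face and the elliptope. *)

(** * Quadrics on the sign cube *)

Definition point n := {ffun 'I_n -> bool}.

Lemma card_point n : #|{: point n}| = (2 ^ n)%N.
Proof. by rewrite card_ffun card_bool card_ord. Qed.

Definition edge n := {e : 'I_n * 'I_n | (e.1 < e.2)%N}.

Lemma card_edge n : #|{: edge n}| = 'C(n, 2).
Proof.
rewrite card_sig -sum1_card -bin2_sum big_mkord.
rewrite -(pair_big_dep xpredT (fun i j : 'I_n => (i < j)%N) (fun _ _ => 1%N)).
rewrite (exchange_big_dep xpredT) //=; apply: eq_bigr => j _.
by rewrite -(big_ord_widen n (fun=> 1%N)) 1?ltnW // sum1_card card_ord.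
Qed.

Definition sgn (F : pzRingType) (b : bool) : F := (-1) ^+ b.
Arguments sgn F b : clear implicits.

Definition monomial (F : pzRingType) n (x : point n) (e : option (edge n)) : F :=
  if e is Some e then sgn F (x (val e).1) * sgn F (x (val e).2) else 1.
Arguments monomial F {n} x e.

(** [None] indexes the constant term.  There are no squares, which are constant
    on sign vectors; so the coefficients are as many as the dimension D(n, 2) of
    the space of quadratic functions on the cube. *)
Definition quadric (F : Type) n := {ffun option (edge n) -> F}.

Definition qeval (F : comPzRingType) n (q : quadric F n) (x : point n) : F :=
  \sum_e q e * monomial F x e.

Definition coef_mx (F : comPzRingType) n (q : quadric F n) : 'M[F]_n :=
  \matrix_(i, j) if insub (i, j) is Some e then q (Some e) else 0.

Lemma coef_mx_edge (F : comPzRingType) n (q : quadric F n) (e : edge n) :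
  coef_mx q (val e).1 (val e).2 = q (Some e).
Proof. by rewrite mxE -surjective_pairing valK. Qed.

Lemma coef_mx_ge (F : comPzRingType) n (q : quadric F n) (i j : 'I_n) :
  (j <= i)%N -> coef_mx q i j = 0.
Proof. by move=> le_ji; rewrite mxE insubF //= ltnNge le_ji. Qed.

Lemma big_option (V : nmodType) (T : finType) (f : option T -> V) :
  \sum_e f e = f None + \sum_e f (Some e).
Proof.
rewrite (bigD1 None) //=; congr (_ + _).
rewrite (reindex_omap Some id) /=; last by case.
by apply: eq_bigl => e; rewrite eqxx.
Qed.

Lemma qevalE (F : comPzRingType) n (q : quadric F n) x :
  qeval q x =
  q None + \sum_i \sum_j coef_mx q i j * (sgn F (x i) * sgn F (x j)).
Proof.
rewrite /qeval big_option mulr1; congr (_ + _); rewrite pair_big /=.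
rewrite [RHS](bigID (fun e : 'I_n * 'I_n => (e.1 < e.2)%N)) /=.
rewrite [X in _ = _ + X]big1 ?addr0; last first.
  by move=> [i j] /=; rewrite -leqNgt => /coef_mx_ge->; rewrite mul0r.
rewrite (reindex_omap (val : edge n -> _) insub) /=; last first.
  by move=> e lt_e; rewrite insubT.
rewrite [RHS](eq_bigl xpredT); last by move=> e; rewrite valK eqxx (valP e).
by apply: eq_bigr => e _; rewrite coef_mx_edge.
Qed.

Definition flip n (i : 'I_n) (x : point n) : point n :=
  [ffun k => x k (+) (k == i)].

Lemma flipK n (i : 'I_n) : involutive (flip i).
Proof. by move=> x; apply/ffunP => k; rewrite !ffunE addbK. Qed.

Lemma monomial_flip (F : comPzRingType) n (i : 'I_n) x (e : edge n) :
  monomial F (flip i x) (Some e) =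
  sgn F (((val e).1 == i) (+) ((val e).2 == i)) * monomial F x (Some e).
Proof. by rewrite /= !ffunE /sgn !signr_addb mulrACA mulrC. Qed.

(** A mixed second difference kills every monomial that is invariant under one of
    the two flips; only the product of the two flipped coordinates changes sign
    under both. *)
Lemma second_difference (F : comPzRingType) n (q : quadric F n) (e : edge n) x :
  qeval q x - qeval q (flip (val e).1 x) - qeval q (flip (val e).2 x)
    + qeval q (flip (val e).1 (flip (val e).2 x)) =
  q (Some e) * monomial F x (Some e) *+ 4.
Proof.
set i := (val e).1; set j := (val e).2; have lt_ij : (i < j)%N := valP e.
rewrite /qeval -!sumrB -big_split /= (bigD1 (Some e)) //=.
have diff (f : edge n) :
    let a := sgn F (((val f).1 == i) (+) ((val f).2 == i)) in
    let b := sgn F (((val f).1 == j) (+) ((val f).2 == j)) in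
    q (Some f) * monomial F x (Some f) - q (Some f) * monomial F (flip i x) (Some f)
    - q (Some f) * monomial F (flip j x) (Some f)
    + q (Some f) * monomial F (flip i (flip j x)) (Some f) =
    q (Some f) * monomial F x (Some f) * ((1 - a) * (1 - b)).
  by move=> a b; rewrite !monomial_flip -/a -/b; ring.
rewrite [X in _ + X]big1 ?addr0 => [|[f|] neq_fe]; last first.
- by rewrite subrr sub0r addNr.
- have {}neq_fe : f != e by apply: contraNneq neq_fe => ->.
  rewrite [LHS]diff.
  have := valP f; have : val f != val e by rewrite (inj_eq val_inj).
  case: (val f) => k l /=; rewrite [val e]surjective_pairing -/i -/j.
  rewrite xpair_eqE => neq lt_kl.
  suff: ~~ (((k == i) (+) (l == i)) && ((k == j) (+) (l == j))).
    by rewrite negb_and => /orP[] /negPf->; rewrite subrr ?mul0r !mulr0.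
  move: neq lt_kl lt_ij; rewrite -!(inj_eq val_inj) /=; move=> {diff}; lia.
rewrite [LHS]diff -/i -/j !eqxx.
have /negPf neq_ji : j != i by rewrite neq_ltn lt_ij orbT.
rewrite neq_ji eq_sym neq_ji [sgn F _]expr1 /=.
move: (_ * sgn F _) => f; ring.
Qed.

(** On each 2-face in the directions of a pair that q couples, the second
    difference of q is nonzero, so q is nonzero at one of the four vertices. *)
Lemma card_nonzero (F : idomainType) n (q : quadric F n) :
  2%:R != 0 :> F -> q != [ffun=> 0] ->
  (2 ^ n <= 4 * #|[set x | qeval q x != 0%R]|)%N.
Proof.
move=> two_neq0 q_neq0.
have [/existsP[e qe_neq0]|] := boolP [exists e, q (Some e) != 0]; last first.
  rewrite negb_exists => /forallP qe0.
  have q0 x : qeval q x = q None.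
    by rewrite /qeval big_option mulr1 big1 ?addr0 // => e _;
       rewrite (eqP (negbNE (qe0 e))) mul0r.
  suff -> : [set x | qeval q x != 0] = [set: point n].
    by rewrite cardsT card_point leq_pmull.
  apply/finset.setP => x; rewrite !inE q0; apply: contraNneq q_neq0 => qN.
  by apply/eqP/ffunP => -[e|]; rewrite ffunE ?qN // (eqP (negbNE (qe0 e))).
pose i := (val e).1; pose j := (val e).2.
pose nz x : nat := qeval q x != 0.
have sum_nz (f : point n -> point n) : involutive f ->
    (\sum_x nz (f x) = #|[set x | qeval q x != 0%R]|)%N.
  move=> fK; transitivity (\sum_x nz x)%N.
    by rewrite [RHS](reindex_inj (inv_inj fK)).
  by rewrite -sum1dep_card [RHS]big_mkcond /=; apply: eq_bigr => x _;
    rewrite /nz; case: eqP.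
have fK x : flip i (flip j (flip i (flip j x))) = x.
  apply/ffunP => k; rewrite !ffunE.
  by case: (x k); case: (k == i); case: (k == j).
have -> : (2 ^ n = \sum_(x : point n) 1)%N by rewrite sum1_card card_point.
have -> : (4 * #|[set x | qeval q x != 0%R]| =
    \sum_x (nz x + nz (flip i x) + nz (flip j x) + nz (flip i (flip j x))))%N.
  rewrite !big_split /= (sum_nz id) // (sum_nz (flip i)) ?(sum_nz (flip j));
    try exact: flipK.
  by rewrite (sum_nz (fun x => flip i (flip j x))) // !mulSn mul0n addn0 !addnA.
apply: leq_sum => x _; rewrite /nz.
have qf_neq0 : q (Some e) * monomial F x (Some e) *+ 4 != 0.
  have four_neq0 : 4%:R != 0 :> F by rewrite (natrM _ 2 2) mulf_neq0.
  by rewrite -[_ *+ 4]mulr_natr !mulf_neq0 // /sgn signr_eq0.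
have := second_difference q e x; rewrite -/i -/j.
do 4![case: eqP => [->|//]].
by rewrite !subr0 addr0 => /esym/eqP; rewrite (negPf qf_neq0).
Qed.

(** Replacing x by [mix I u y] makes the coordinates inside and outside I
    independent variables while keeping a full cube for both. *)
Definition mix n (I : pred 'I_n) (u y : point n) : point n :=
  [ffun i => if I i then u i else y i].

(** Exchanging the coordinates outside I between u and y is an involution of the
    pairs (u, y) whose first component is [mix I u y]. *)
Lemma sum_mix (V : nmodType) n (I : pred 'I_n) (f : point n -> V) :
  \sum_u \sum_y f (mix I u y) = (\sum_x f x) *+ 2 ^ n.
Proof.
rewrite pair_big /=.
have swapK : involutive (fun p : point n * point n => (mix I p.1 p.2, mix I p.2 p.1)).
  by case=> u y; congr (_, _); apply/ffunP => i; rewrite !ffunE; case: (I i).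
rewrite (reindex_inj (inv_inj swapK)) /=.
rewrite (eq_bigr (fun p => f p.1)); last first.
  move=> [u y] _ /=; congr f.
  by apply/ffunP => i; rewrite !ffunE; case: (I i).
rewrite -(pair_big xpredT xpredT (fun u y => f u)) /= exchange_big /=.
by rewrite sumr_const card_point.
Qed.

(** The coefficients of q across the bipartition I, padded with zeros to a square
    matrix so that its rank can be compared for different I. *)
Definition cut_mx (F : comPzRingType) n (I : pred 'I_n) (q : quadric F n) : 'M[F]_n :=
  \matrix_(i, j) if I i && ~~ I j then coef_mx q i j + coef_mx q j i else 0.

Definition sgnv (F : pzRingType) n (x : point n) : 'cV[F]_n :=
  \col_i sgn F (x i).
Arguments sgnv F {n} x.

Lemma qeval_mix (F : comPzRingType) n (I : pred 'I_n) (q : quadric F n) :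
  exists a b : point n -> F, forall u y, qeval q (mix I u y) =
    a u + b y + \sum_i sgn F (u i) * (cut_mx I q *m sgnv F y) i 0.
Proof.
pose part (J : pred 'I_n) x :=
  \sum_i \sum_j (if J i && J j then coef_mx q i j else 0) * (sgn F (x i) * sgn F (x j)).
exists (fun u => q None + part I u), (part (predC I)) => u y.
rewrite qevalE -!addrA; congr (_ + _).
have -> : \sum_i sgn F (u i) * (cut_mx I q *m sgnv F y) i 0 =
  \sum_i \sum_j (if I i && ~~ I j then coef_mx q i j else 0) *
      (sgn F (u i) * sgn F (y j))
  + \sum_i \sum_j (if I j && ~~ I i then coef_mx q i j else 0) *
      (sgn F (u j) * sgn F (y i)).
  rewrite [X in _ = _ + X]exchange_big -big_split; apply: eq_bigr => i _ /=.
  rewrite mxE mulr_sumr -big_split; apply: eq_bigr => j _ /=; rewrite !mxE.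
  by case: ifP => _; ring.
rewrite -!big_split; apply: eq_bigr => i _ /=.
rewrite -!big_split; apply: eq_bigr => j _ /=; rewrite !ffunE.
by case: (I i); case: (I j) => /=; ring.
Qed.

Definition scale (F : comPzRingType) n (a : F) (q : quadric F n) : quadric F n :=
  [ffun e => a * q e].

Lemma qeval_scale (F : comPzRingType) n a (q : quadric F n) x :
  qeval (scale a q) x = a * qeval q x.
Proof. by rewrite /qeval mulr_sumr; apply: eq_bigr => e _; rewrite ffunE mulrA. Qed.

Lemma cut_mx_scale (F : comPzRingType) n I a (q : quadric F n) :
  cut_mx I (scale a q) = a *: cut_mx I q.
Proof.
have coef_scale i j : coef_mx (scale a q) i j = a * coef_mx q i j.
  by rewrite !mxE; case: insub => [e|]; rewrite ?ffunE ?mulr0.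
apply/matrixP => i j; rewrite [LHS]mxE [RHS]mxE [X in _ = _ * X]mxE !coef_scale.
by case: ifP; rewrite ?mulr0 ?mulrDr.
Qed.

(** Any two indices differ in some binary digit, so logarithmically many
    bipartitions separate all pairs. *)
Definition digit n (t : nat) (i : 'I_n) : bool := odd (i %/ 2 ^ t).

Lemma digit_neq l i j : (i < 2 ^ l)%N -> (j < 2 ^ l)%N -> i != j ->
  exists2 t, (t < l)%N & odd (i %/ 2 ^ t) != odd (j %/ 2 ^ t).
Proof.
elim: l i j => [|l IHl] i j.
  by rewrite expn0 !ltnS !leqn0 => /eqP-> /eqP->.
rewrite expnS => lt_i lt_j neq_ij.
have [eq_odd|neq_odd] := eqVneq (odd i) (odd j); last first.
  by exists 0%N; rewrite // expn0 !divn1.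
have [||| t lt_tl neq] := IHl (i %/ 2)%N (j %/ 2)%N; try lia.
by exists t.+1; rewrite ?ltnS // expnS !divnMA.
Qed.

Lemma cut_mx_digit_inj (F : comPzRingType) n l (q q' : quadric F n) :
  (n <= 2 ^ l)%N -> q None = q' None ->
  (forall t, (t < l)%N -> cut_mx (digit t) q = cut_mx (digit t) q') -> q = q'.
Proof.
move=> le_n eqN eq_cut; apply/ffunP => -[e|//].
have lt_e := valP e; set i := (val e).1 in lt_e; set j := (val e).2 in lt_e.
have neq_ij : i != j :> nat by rewrite neq_ltn lt_e.
have [t lt_tl] := digit_neq (leq_trans (ltn_ord i) le_n) (leq_trans (ltn_ord j) le_n) neq_ij.
have /matrixP eq_t := eq_cut t lt_tl.
case di: (odd (i %/ 2 ^ t)); case dj: (odd (j %/ 2 ^ t)) => // _.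
  have := eq_t i j; rewrite !mxE /digit di dj /= -!coef_mx_edge.
  by rewrite !mxE -!surjective_pairing !valK !insubF ?addr0 //= ltnNge ltnW.
have := eq_t j i; rewrite !mxE /digit di dj /= -!coef_mx_edge.
by rewrite !mxE -!surjective_pairing !valK !insubF ?add0r //= ltnNge ltnW.
Qed.

(** A matrix of rank at most r factors through dimension r. *)
Lemma card_rank_le (F : finFieldType) n r :
  (#|[set M : 'M[F]_n | (\rank M <= r)%N]| <= #|F| ^ (2 * n * r))%N.
Proof.
pose mul (p : 'M[F]_(n, r) * 'M[F]_(r, n)) : 'M[F]_n := p.1 *m p.2.
apply: (@leq_trans #|mul @: [set: 'M[F]_(n, r) * 'M[F]_(r, n)]|).
  apply: subset_leq_card; apply/fintype.subsetP => M; rewrite inE => rkM.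
  apply/imsetP; exists (col_ebase M *m pid_mx (\rank M),
                        pid_mx (\rank M) *m row_ebase M); first by rewrite inE.
  rewrite /mul /= -mulmxA [pid_mx _ *m (_ *m _)]mulmxA mul_pid_mx.
  by rewrite minnn (minn_idPr rkM) mulmxA mulmx_ebase.
apply: (leq_trans (leq_imset_card _ _)).
by rewrite cardsT card_prod !card_mx -expnD [(r * n)%N]mulnC addnn -mul2n mulnA.
Qed.

(** Odlyzko's bound.  Select \rank D independent columns of D: two sign
    solutions that agree on the other coordinates have a difference supported on
    these columns and killed by D, hence they coincide. *)
Lemma card_sign_solutions (F : fieldType) m n (D : 'M[F]_(m, n)) v :
  2%:R != 0 :> F ->
  (#|[set y : point n | D *m sgnv F y == v]| <= 2 ^ (n - \rank D))%N.
Proof.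
move=> two_neq0; set f := maxrankfun D^T.
have f_inj : injective f := @maxrankfun_inj _ _ _ D^T.
have f_free : row_free (rowsub f D^T) by exact: maxrowsub_free.
pose C := ~: (f @: [set: 'I_(\rank D^T)]).
have cardC : #|C| = (n - \rank D)%N.
  by rewrite cardsCs finset.setCK card_imset // cardsT !card_ord mxrank_tr.
rewrite -cardC -card_powerset.
pose g (y : point n) := [set i | y i] :&: C.
rewrite -(@card_in_imset _ _ g); last first.
  move=> y y'; rewrite !inE => /eqP Dy /eqP Dy' eq_g.
  have eqC i : i \in C -> y i = y' i.
    by move=> iC; move/finset.setP/(_ i): eq_g; rewrite !finset.in_setI iC !andbT !inE.
  have diff0 : (sgnv F y - sgnv F y')^T *m D^T = 0.
    by rewrite -trmx_mul mulmxBr Dy Dy' subrr trmx0.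
  pose c : 'rV[F]_(\rank D^T) := \row_k (sgn F (y (f k)) - sgn F (y' (f k))).
  have c0 : c *m rowsub f D^T = 0.
    rewrite -diff0; apply/rowP => j; rewrite !mxE.
    rewrite [RHS](bigID (mem (f @: [set: 'I_(\rank D^T)]))) /=.
    rewrite [X in _ = _ + X]big1 ?addr0 => [|i iC]; last first.
      by rewrite !mxE eqC ?subrr ?mul0r // inE.
    rewrite big_imset /=; last by move=> ? ? _ _; apply: f_inj.
    rewrite [RHS](eq_bigl xpredT) => [|k]; last by rewrite inE.
    by apply: eq_bigr => k _; rewrite !mxE.
  have {}c0 : c = 0 by apply: (row_free_inj f_free); rewrite c0 mul0mx.
  apply/ffunP => i; case: (boolP (i \in C)) => [/eqC //|].
  rewrite inE negbK => /imsetP[k _ ->].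
  move/rowP/(_ k): c0; rewrite !mxE /sgn => /eqP.
  case: (y (f k)); case: (y' (f k)) => //; rewrite expr1 expr0.
    by rewrite -opprD oppr_eq0 (negPf two_neq0).
  by rewrite opprK (negPf two_neq0).
apply: subset_leq_card; apply/fintype.subsetP => _ /imsetP[y _ ->].
by rewrite inE finset.subsetIr.
Qed.

Lemma card_bigcup_le (I T : finType) (A : I -> {set T}) :
  (#|\bigcup_i A i| <= \sum_i #|A i|)%N.
Proof.
elim/big_rec2: _ => [|i m U _ le_mU]; first by rewrite cards0.
by rewrite (leq_trans (leq_card_setU _ _)) ?leq_add2l.
Qed.

(** If B (y - y') has at most s nonzero entries, then y and y' have the same
    image under B with s suitable rows erased, of rank at least \rank B - s.
    There are at most n ^ s choices for these rows. *)
Lemma card_sparse_image (F : fieldType) n s (B : 'M[F]_n) :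
  2%:R != 0 :> F -> (0 < n)%N ->
  (#|[set p : point n * point n |
       #|[set i | (B *m (sgnv F p.1 - sgnv F p.2)) i 0%R != 0%R]| <= s]|
     <= n ^ s * (2 ^ n * 2 ^ (n - (\rank B - s))))%N.
Proof.
move=> two_neq0 n_gt0.
pose D (f : {ffun 'I_s -> 'I_n}) : 'M[F]_n :=
  \matrix_(i, j) if i \in f @: [set: 'I_s] then 0 else B i j.
pose sol f (y' : point n) := [set y : point n | D f *m sgnv F y == D f *m sgnv F y'].
have rkD f : (\rank B - s <= \rank (D f))%N.
  rewrite leq_subLR -[X in (\rank X <= _)%N](subrK (D f)).
  apply: (leq_trans (mxrank_add _ _)); rewrite leq_add2r.
  apply: (@leq_trans (\rank (rowsub f B))); last exact: rank_leq_row.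
  apply: mxrankS; apply/row_subP => i.
  have [/imsetP[k _ ->]|i_notin] := boolP (i \in f @: [set: 'I_s]).
    rewrite (_ : row _ _ = row k (rowsub f B)) ?row_sub //.
    by apply/rowP => j; rewrite !mxE imset_f ?subr0.
  rewrite (_ : row _ _ = 0) ?sub0mx //.
  by apply/rowP => j; rewrite !mxE (negPf i_notin) subrr.
have card_sol f y' : (#|sol f y'| <= 2 ^ (n - (\rank B - s)))%N.
  apply: (leq_trans (card_sign_solutions _ _ _)) => //.
  by rewrite leq_exp2l // leq_sub2l.
set S := [set p | _].
have subS : S \subset \bigcup_f \bigcup_y' finset.setX (sol f y') [set y'].
  apply/fintype.subsetP => -[y y']; rewrite inE /=; set Z := [set i | _] => le_Zs.
  have [f Zf] : exists f : {ffun 'I_s -> 'I_n}, Z \subset f @: [set: 'I_s].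
    exists [ffun k : 'I_s => nth (Ordinal n_gt0) (enum Z) k].
    apply/fintype.subsetP => i iZ; apply/imsetP.
    have lt_s : (index i (enum Z) < s)%N.
      by apply: leq_trans le_Zs; rewrite cardE index_mem mem_enum.
    by exists (Ordinal lt_s); rewrite // ffunE /= nth_index // mem_enum.
  apply/finset.bigcupP; exists f => //; apply/finset.bigcupP; exists y' => //.
  rewrite !inE eqxx andbT -subr_eq0 -mulmxBr; apply/eqP/colP => i.
  rewrite !mxE; have [fi|fi] := boolP (i \in f @: [set: 'I_s]).
    by rewrite big1 // => j _; rewrite mxE fi mul0r.
  have : i \notin Z by apply: contra fi; apply: (fintype.subsetP Zf).
  rewrite inE negbK => /eqP Bz0; rewrite -[RHS]Bz0 [RHS]mxE.
  by apply: eq_bigr => j _; rewrite !mxE (negPf fi).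
apply: (leq_trans (subset_leq_card subS)).
apply: (leq_trans (card_bigcup_le _)).
apply: (@leq_trans (\sum_(f : {ffun 'I_s -> 'I_n}) 2 ^ n * 2 ^ (n - (\rank B - s)))%N).
  apply: leq_sum => f _; apply: (leq_trans (card_bigcup_le _)).
  apply: (@leq_trans (\sum_(y' : point n) 2 ^ (n - (\rank B - s)))%N).
    by apply: leq_sum => y' _; rewrite cardsX cards1 muln1.
  by rewrite sum_nat_const card_point.
by rewrite sum_nat_const card_ffun !card_ord.
Qed.

(** * Character sums modulo p *)

Lemma sqr_sum_le (F : numDomainType) (I : finType) (f : I -> F) :
  (forall i, 0 <= f i) -> (\sum_i f i) ^+ 2 <= #|I|%:R * \sum_i f i ^+ 2.
Proof.
move=> f_ge0; rewrite -(ler_pMn2r (isT : (0 < 2)%N)).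
have -> : #|I|%:R * (\sum_i f i ^+ 2) *+ 2 =
    \sum_i \sum_j (f i ^+ 2 + f j ^+ 2).
  under [RHS]eq_bigr do rewrite big_split sumr_const.
  rewrite big_split /= sumr_const -sumrMnl mulr2n mulr_natl.
  by congr (_ + _); rewrite sumrMnl.
rewrite expr2 mulr_suml -sumrMnl; apply: ler_sum => i _.
rewrite mulr_sumr -sumrMnl; apply: ler_sum => j _.
by apply: (real_leif_mean_square_scaled _ _).1; apply: ger0_real.
Qed.

(** Bernoulli gives (1 + 1/k)^k >= 2, and (1 - 1/k)(1 + 1/k) <= 1. *)
Lemma half_contraction (F : numFieldType) k :
  (0 < k)%N -> 2%:R * (1 - k%:R^-1) ^+ k <= 1 :> F.
Proof.
move=> k_gt0; set e : F := k%:R^-1.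
have k_gt0C : 0 < k%:R :> F by rewrite ltr0n.
have e_ge0 : 0 <= e by rewrite invr_ge0 ler0n.
have e_le1 : e <= 1 by rewrite invf_le1 // ler1n.
have bern j : 1 + j%:R * e <= (1 + e) ^+ j.
  elim: j => [|j IHj]; first by rewrite mul0r addr0 expr0.
  rewrite exprS; apply: (@le_trans _ _ ((1 + e) * (1 + j%:R * e))); last first.
    by rewrite ler_wpM2l // addr_ge0.
  have -> : (1 + e) * (1 + j%:R * e) = 1 + j.+1%:R * e + e * (j%:R * e).
    by rewrite -natr1; ring.
  by rewrite lerDl !mulr_ge0.
have two_le : 2%:R <= (1 + e) ^+ k.
  by apply: le_trans (bern k); rewrite divff ?gt_eqF // -natr1.
have e1_ge0 : 0 <= 1 - e by rewrite subr_ge0.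
apply: (@le_trans _ _ ((1 + e) ^+ k * (1 - e) ^+ k)).
  by rewrite ler_wpM2r // exprn_ge0.
rewrite -exprMn exprn_ile1 //; first by rewrite mulr_ge0 // addr_ge0.
by rewrite mulrDl mul1r mulrBr mulr1 addrA subrK gerBl mulr_ge0.
Qed.

Lemma Fp_two_neq0 p : prime p -> odd p -> 2%:R != 0 :> 'F_p.
Proof.
move=> p_pr p_odd; rewrite -(dvdn_pcharf (pchar_Fp p_pr)) gtnNdvd //.
by rewrite ltn_neqAle prime_gt1 // andbT; apply: contraTneq p_odd => <-.
Qed.

Section Characters.
Variables (C : numClosedFieldType) (p : nat) (w : C).
Hypotheses (p_pr : prime p) (p_odd : odd p) (w_prim : p.-primitive_root w).

Let p_gt0 : (0 < p)%N := prime_gt0 p_pr.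

Definition chi (t : 'F_p) : C := w ^+ (t : nat).

Lemma chi_nat k : chi k%:R = w ^+ k.
Proof. by rewrite /chi val_Fp_nat // (prim_expr_mod w_prim). Qed.

Lemma chiD a b : chi (a + b) = chi a * chi b.
Proof. by rewrite -[a]natr_Zp -[b]natr_Zp -natrD !chi_nat exprD. Qed.

Lemma chi0 : chi 0 = 1. Proof. by rewrite /chi expr0. Qed.

Lemma norm_chi a : `|chi a| = 1.
Proof.
rewrite /chi normrX; suff -> : `|w| = 1 by rewrite expr1n.
apply/eqP; rewrite -(@pexpr_eq1 _ _ p) ?normr_ge0 //.
by rewrite -normrX (prim_expr_order w_prim) normr1.
Qed.

Lemma conj_chi a : (chi a)^* = chi (- a).
Proof.
have chi_neq0 : chi a != 0 by rewrite -normr_eq0 norm_chi oner_eq0.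
by apply: (mulfI chi_neq0); rewrite -normCK norm_chi expr1n -chiD subrr chi0.
Qed.

Lemma chi_eq1 a : (chi a == 1) = (a == 0).
Proof.
rewrite /chi -(prim_order_dvd w_prim).
have lt_ap : (a < p)%N by rewrite -[X in (_ < X)%N](Fp_cast p_pr).
apply/idP/eqP => [|->]; last by rewrite dvdn0.
case a0 : (a : nat) => [|k]; first by move=> _; apply: val_inj.
by move/dvdn_leq => /(_ isT); rewrite -a0 leqNgt lt_ap.
Qed.

Lemma chi_sum (I : finType) (f : I -> 'F_p) :
  chi (\sum_i f i) = \prod_i chi (f i).
Proof. by apply: (big_morph chi chiD chi0). Qed.

Lemma sum_chi t : \sum_(a : 'F_p) chi (a * t) = if t == 0 then p%:R else 0.
Proof.
have [->|t_neq0] := eqVneq t 0.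
  under eq_bigr do rewrite mulr0 chi0.
  by rewrite sumr_const card_Fp.
have : chi t * (\sum_(a : 'F_p) chi (a * t)) = \sum_(a : 'F_p) chi (a * t).
  rewrite mulr_sumr [RHS](reindex_inj (addIr 1)) /=; apply: eq_bigr => a _.
  by rewrite mulrDl mul1r addrC chiD.
move/eqP; rewrite -subr_eq0 -{2}[\sum_a _]mul1r -mulrBl mulf_eq0 subr_eq0.
by rewrite chi_eq1 (negPf t_neq0) => /eqP.
Qed.

(** Let v = chi t.  The p numbers v ^+ k sum to 0, so the numbers 1 - v ^+ k sum
    to p; and each of them is at most k |1 - v|. *)
Lemma chi_gap t : t != 0 -> 1 <= p%:R * `|1 - chi t|.
Proof.
move=> t_neq0; set v := chi t.
have vp : v ^+ p = 1 by rewrite /v /chi exprAC (prim_expr_order w_prim) expr1n.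
have sum_v : \sum_(k < p) v ^+ k = 0.
  have := subrX1 v p; rewrite vp subrr => /esym/eqP; rewrite mulf_eq0 subr_eq0.
  by rewrite chi_eq1 (negPf t_neq0) => /eqP.
have le_k k : `|1 - v ^+ k| <= k%:R * `|1 - v|.
  rewrite -normrN opprB subrX1 normrM distrC mulrC ler_wpM2r ?normr_ge0 //.
  apply: (le_trans (ler_norm_sum _ _ _)).
  rewrite (eq_bigr (fun=> 1)) ?sumr_const ?card_ord // => i _.
  by rewrite normrX norm_chi expr1n.
have le_p : p%:R <= p%:R * (p%:R * `|1 - v|).
  have sumE : p%:R = `|\sum_(k < p) (1 - v ^+ k)| :> C.
    by rewrite sumrB sum_v subr0 sumr_const card_ord normr_nat.
  rewrite [X in X <= _]sumE; apply: (le_trans (ler_norm_sum _ _ _)).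
  apply: (@le_trans _ _ (\sum_(k < p) p%:R * `|1 - v|)).
    apply: ler_sum => k _; apply: (le_trans (le_k k)).
    by rewrite ler_wpM2r ?normr_ge0 // ler_nat ltnW.
  by rewrite sumr_const card_ord -[X in X <= _]mulr_natl.
by rewrite -[X in X <= _]mulr1 ler_pM2l ?ltr0n // in le_p.
Qed.

(** The norm is |v + 1| for v = chi (t + t), and |v + 1|^2 + |v - 1|^2 = 4. *)
Lemma chi_cos_gap t : t != 0 ->
  `|chi t + chi (- t)| ^+ 2 <= 4%:R * (1 - (4 * p ^ 2)%:R^-1 : C) :> C.
Proof.
move=> t_neq0; set v := chi (t + t).
have t2_neq0 : t + t != 0.
  by rewrite -mulr2n -mulr_natr mulf_neq0 // Fp_two_neq0.
have -> : `|chi t + chi (- t)| = `|v + 1|.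
  have -> : v + 1 = chi t * (chi t + chi (- t)).
    by rewrite mulrDr -!chiD subrr chi0.
  by rewrite normrM norm_chi mul1r.
have par : `|v + 1| ^+ 2 = 4%:R - `|1 - v| ^+ 2.
  apply/eqP; rewrite eq_sym subr_eq !normCK !rmorphD rmorphN rmorph1 /=.
  have := normCK v; rewrite norm_chi expr1n => vv.
  by apply/eqP; rewrite !mulrDl !mulrDr !mulrN !mulNr !mulr1 !mul1r -vv; ring.
rewrite par mulrBr mulr1 lerD2l lerN2 natrM invfM mulrA divff ?mul1r ?pnatr_eq0 //.
rewrite natrX -exprVn ler_pXn2r ?nnegrE ?invr_ge0 ?ler0n ?normr_ge0 //.
rewrite -[X in X <= _]mul1r ler_pdivrMr ?ltr0n // mulrC.
exact: chi_gap.
Qed.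

Definition expsum n (q : quadric 'F_p n) : C := \sum_x chi (qeval q x).

Lemma expsum_zeros n (q : quadric 'F_p n) :
  p%:R * #|[set x | qeval q x == 0]|%:R = \sum_a expsum (scale a q).
Proof.
rewrite exchange_big /= -sum1dep_card natr_sum mulr_sumr [LHS]big_mkcond /=.
apply: eq_bigr => x _.
under eq_bigr do rewrite qeval_scale.
by rewrite sum_chi mulr1.
Qed.

(** The product of the |2 cos (2 pi v_i / p)|, which is the norm of the sum of
    chi (u^T v) over all sign vectors u. *)
Definition cosprod n (v : 'cV['F_p]_n) : C :=
  \prod_i `|chi (v i 0) + chi (- v i 0)|.

(** After the substitution x = mix I u y, the part of the phase that depends on u
    alone disappears in the norm of the inner sum over y.  Cauchy-Schwarz over u
    then duplicates y, and what remains is linear in u, so that the sum over u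
    factors. *)
Lemma expsum_decouple n (I : pred 'I_n) (q : quadric 'F_p n) :
  (2 ^ n)%:R * `|expsum q| ^+ 2 <=
  \sum_y \sum_y' cosprod (cut_mx I q *m (sgnv 'F_p y - sgnv 'F_p y')).
Proof.
have N_gt0 : 0 < (2 ^ n)%:R :> C by rewrite ltr0n expn_gt0.
have [a [b qE]] := qeval_mix I q.
pose lin (u y : point n) := \sum_i sgn 'F_p (u i) * (cut_mx I q *m sgnv 'F_p y) i 0.
pose G u := \sum_y chi (b y + lin u y).
have TE : (2 ^ n)%:R * `|expsum q| <= \sum_u `|G u|.
  rewrite -[X in X * _]normr_nat -normrM mulr_natl -(sum_mix I).
  apply: (le_trans (ler_norm_sum _ _ _)); apply: ler_sum => u _.
  under eq_bigr do rewrite qE -addrA chiD.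
  by rewrite -mulr_sumr normrM norm_chi mul1r.
have {}TE : (2 ^ n)%:R * `|expsum q| ^+ 2 <= \sum_u `|G u| ^+ 2.
  rewrite -(ler_pM2l N_gt0) mulrA -expr2 -exprMn.
  rewrite -{2}card_point; apply: le_trans (sqr_sum_le _); last by move=> u.
  by rewrite ler_pXn2r // ?nnegrE ?mulr_ge0 ?ler0n ?sumr_ge0.
apply: (le_trans TE).
have -> : \sum_u `|G u| ^+ 2 = `|\sum_u `|G u| ^+ 2|.
  by rewrite ger0_norm // sumr_ge0 // => u _; rewrite exprn_ge0.
have GE u : `|G u| ^+ 2 = \sum_y \sum_y' chi (b y - b y') *
    \prod_i chi (sgn 'F_p (u i) * (cut_mx I q *m (sgnv 'F_p y - sgnv 'F_p y')) i 0).
  rewrite normCK rmorph_sum mulr_suml; apply: eq_bigr => y _.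
  rewrite mulr_sumr; apply: eq_bigr => y' _.
  rewrite /= conj_chi -chi_sum -!chiD; congr chi.
  rewrite opprD addrACA; congr (_ + _).
  rewrite -sumrB; apply: eq_bigr => i _.
  by rewrite mulmxBr !mxE mulrBr.
under eq_bigr do rewrite GE.
rewrite exchange_big /=; apply: (le_trans (ler_norm_sum _ _ _)).
apply: ler_sum => y _; rewrite exchange_big /=.
apply: (le_trans (ler_norm_sum _ _ _)); apply: ler_sum => y' _.
rewrite -mulr_sumr normrM norm_chi mul1r.
rewrite -(bigA_distr_bigA (fun i (c : bool) =>
  chi (sgn 'F_p c * (cut_mx I q *m (sgnv 'F_p y - sgnv 'F_p y')) i 0))) /=.
rewrite normr_prod /cosprod le_eqVlt; apply/orP; left; apply/eqP.
by apply: eq_bigr => i _; rewrite big_bool /sgn /= expr1 expr0 mul1r mulN1r addrC.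
Qed.

Lemma norm_chi_cos_le2 (t : 'F_p) : `|chi t + chi (- t)| <= 2%:R.
Proof. by apply: (le_trans (ler_normD _ _)); rewrite !norm_chi. Qed.

Lemma cosprod_ge0 n (v : 'cV['F_p]_n) : 0 <= cosprod v.
Proof. exact: prodr_ge0. Qed.

Lemma cosprod_le n (v : 'cV['F_p]_n) : cosprod v <= (2 ^ n)%:R.
Proof.
rewrite natrX -[X in _ ^+ X]card_ord -prodr_const.
by apply: ler_prod => i _; rewrite normr_ge0 norm_chi_cos_le2.
Qed.

(** Each nonzero v_i costs a factor 1 - 1/(4 p^2) in the square of the product;
    8 p^2 of them halve the product. *)
Lemma cosprod_contract n h s (v : 'cV['F_p]_n) :
  (8 * p ^ 2 * h <= s)%N -> (s < #|[set i | v i 0%R != 0%R]|)%N ->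
  cosprod v * (2 ^ h)%:R <= (2 ^ n)%:R.
Proof.
move=> le_hs; set Z := [set i | _] => lt_s.
set k := (4 * p ^ 2)%N; set c : C := 1 - k%:R^-1.
have k_gt0 : (0 < k)%N by rewrite muln_gt0 expn_gt0 p_gt0.
have c_ge0 : 0 <= c by rewrite subr_ge0 invf_le1 ?ltr0n // ler1n.
have c_le1 : c <= 1 by rewrite gerBl invr_ge0 ler0n.
rewrite -(@ler_pXn2r _ 2) ?nnegrE ?mulr_ge0 ?cosprod_ge0 ?ler0n //.
rewrite exprMn -prodrXl.
apply: (@le_trans _ _ ((\prod_(i < n) (4%:R * (if i \in Z then c else 1))) *
                       (2 ^ h)%:R ^+ 2)).
  rewrite ler_wpM2r ?exprn_ge0 ?ler0n //; apply: ler_prod => i _.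
  rewrite exprn_ge0 ?normr_ge0 //= inE; case: eqP => [_|/eqP vi] /=.
    rewrite mulr1 (natrM _ 2 2) -expr2.
    by rewrite ler_pXn2r ?nnegrE ?normr_ge0 ?ler0n // norm_chi_cos_le2.
  exact: chi_cos_gap.
rewrite big_split /= prodr_const card_ord -mulrA -[leRHS]mulr1.
have -> : (2 ^ n)%:R ^+ 2 = 4%:R ^+ n :> C.
  by rewrite -!natrX -expnM mulnC expnM.
rewrite ler_wpM2l ?exprn_ge0 ?ler0n //.
rewrite -big_mkcond /= prodr_const.
apply: (@le_trans _ _ (c ^+ (k * (2 * h)) * (2 ^ h)%:R ^+ 2)).
  rewrite ler_wpM2r ?exprn_ge0 ?ler0n // ler_wiXn2l // ltnW //.
  by apply: leq_ltn_trans lt_s; apply: leq_trans le_hs; rewrite /k; lia.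
rewrite -natrX -expnM [(h * 2)%N]mulnC exprM natrX -exprMn.
rewrite exprn_ile1 ?mulr_ge0 ?exprn_ge0 ?ler0n //.
by rewrite mulrC half_contraction.
Qed.

(** The pairs with sparse image are bounded trivially, the others by
    cosprod_contract. *)
Lemma expsum_le n h s (I : pred 'I_n) (q : quadric 'F_p n) :
  (8 * p ^ 2 * h <= s)%N ->
  (2 ^ h * #|[set y : point n * point n |
     #|[set i | (cut_mx I q *m (sgnv 'F_p y.1 - sgnv 'F_p y.2)) i 0%R != 0%R]| <= s]|
     <= 2 ^ n * 2 ^ n)%N ->
  (2 ^ h)%:R * `|expsum q| ^+ 2 <= 2%:R * (2 ^ n)%:R ^+ 2.
Proof.
move=> le_hs; set S := [set y | _] => le_S.
have N_gt0 : 0 < (2 ^ n)%:R :> C by rewrite ltr0n expn_gt0.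
rewrite -(ler_pM2l N_gt0) mulrCA.
apply: (le_trans (ler_wpM2l _ (expsum_decouple I q))); first exact: ler0n.
rewrite pair_big /= mulr_sumr.
apply: (@le_trans _ _ (\sum_(y : point n * point n)
    ((2 ^ n)%:R + (if y \in S then (2 ^ n * 2 ^ h)%:R else 0)))).
  apply: ler_sum => -[y y'] _ /=; rewrite inE /= mulrC.
  case: leqP => [_|lt_s].
    rewrite natrM -[leLHS]add0r lerD ?ler0n //.
    by rewrite ler_wpM2r ?ler0n // cosprod_le.
  by rewrite addr0 (cosprod_contract le_hs).
rewrite big_split /= -big_mkcond /= !sumr_const card_prod !card_point.
rewrite -natrX -!natrM -!mulrnA -natrD ler_nat.
rewrite -mulnA -mulnDr leq_pmul2l ?expn_gt0 // expnS expn1 mul2n -addnn.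
by rewrite leq_add2l.
Qed.

(** p times the number of zeros is the sum of all the exponential sums of the
    multiples a q.  The multiple a = 0 contributes the main term 2 ^ n, and each
    of the others at most 2 ^ (n - g), as a q has the same rank across I. *)
Lemma equidistribution_in n l g s (I : pred 'I_n) (q : quadric 'F_p n) :
  (0 < n)%N -> (n <= 2 ^ l)%N -> (8 * p ^ 2 * (2 * g + 1) <= s)%N ->
  (l.+1 * s + (2 * g + 1) <= \rank (cut_mx I q))%N ->
  (p * 2 ^ g * #|[set x | qeval q x == 0%R]| <= 2 ^ n * (2 ^ g + p))%N.
Proof.
move=> n_gt0 le_nl le_s le_rk; set h := (2 * g + 1)%N in le_s le_rk.
have s_gt0 : (0 < s)%N by apply: leq_trans le_s; rewrite /h addn1 !muln_gt0 ?expn_gt0 ?p_gt0.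
have two_neq0 := Fp_two_neq0 p_pr p_odd.
have le_esum a : a != 0 -> (2 ^ g)%:R * `|expsum (scale a q)| <= (2 ^ n)%:R.
  move=> a_neq0; rewrite -(@ler_pXn2r _ 2) ?nnegrE ?mulr_ge0 ?ler0n ?normr_ge0 //.
  rewrite -(ler_pM2l (ltr0n _ 2 : 0 < 2%:R :> C)) exprMn mulrA.
  have -> : 2%:R * (2 ^ g)%:R ^+ 2 = (2 ^ h)%:R :> C.
    by rewrite /h addn1 expnS [(2 * g)%N]mulnC expnM -natrX -natrM.
  apply: (expsum_le (I := I) le_s); rewrite cut_mx_scale.
  have rk_a : \rank (a *: cut_mx I q) = \rank (cut_mx I q) by rewrite eqmx_scale.
  apply: (leq_trans (leq_mul (leqnn _) (card_sparse_image s _ two_neq0 n_gt0))).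
  rewrite rk_a; move: (\rank _) (rank_leq_row (cut_mx I q)) le_rk => k le_kn le_rk.
  apply: (@leq_trans (2 ^ h * (2 ^ (l * s) * (2 ^ n * 2 ^ (n - (k - s))))))%N.
    by rewrite leq_mul2l leq_mul2r expnM leq_exp2r ?le_nl ?orbT.
  rewrite -!expnD leq_exp2l //.
  by move: le_rk; rewrite mulSn; move: (l * s)%N => ls; lia.
rewrite -(ler_nat C) natrM [X in _ <= X]natrM natrD natrM.
set Z := #|_|.
have sumE : p%:R * Z%:R - (2 ^ n)%:R = \sum_(a | a != 0) expsum (scale a q).
  rewrite expsum_zeros (bigD1 0) //= addrAC.
  have -> : expsum (scale 0 q) = (2 ^ n)%:R.
    rewrite /expsum (eq_bigr (fun=> 1)) => [|x _].
      by rewrite sumr_const card_point.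
    by rewrite qeval_scale mul0r chi0.
  by rewrite subrr add0r.
rewrite mulrAC mulrDr -lerBlDl mulrC [X in _ - X]mulrC -mulrBr sumE.
apply: (@le_trans _ _ ((2 ^ g)%:R * `|\sum_(a | a != 0) expsum (scale a q)|)).
  rewrite ler_wpM2l ?ler0n // real_ler_norm // -sumE.
  by rewrite rpredB ?rpredM ?realn.
apply: (le_trans (ler_wpM2l (ler0n _ _) (ler_norm_sum _ _ _))).
rewrite mulr_sumr; apply: (@le_trans _ _ (\sum_(a : 'F_p | a != 0) (2 ^ n)%:R)).
  exact: ler_sum.
rewrite sumr_const -[_ *+ _]mulr_natr -!natrM ler_nat leq_mul2l.
by rewrite -[X in (_ <= X)%N](card_Fp p_pr) max_card orbT.
Qed.

End Characters.

(** * Counting degenerate arrays modulo p *)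

(** By induction (1 + P/G)^k (1 - k P/G) <= 1 for k <= K, and the second factor
    is at least 1/2. *)
Lemma compound_le K P G : (2 * (K * P) <= G)%N -> ((G + P) ^ K <= 2 * G ^ K)%N.
Proof.
move=> le_G; have step k : (k <= K)%N -> ((G + P) ^ k * (G - k * P) <= G ^ k.+1)%N.
  elim: k => [|k IHk] lt_k; first by rewrite mul0n subn0 expn0 mul1n expn1.
  rewrite expnSr [X in (_ <= X)%N]expnSr.
  apply: (@leq_trans ((G + P) ^ k * (G - k * P) * G)%N); last first.
    by rewrite leq_mul2r IHk ?orbT // ltnW.
  rewrite -!mulnA leq_mul2l; apply/orP; right.
  have le_kP : (k.+1 * P <= G)%N.
    by apply: leq_trans le_G; rewrite (@leq_trans (K * P)%N) ?leq_mul2r ?lt_k ?orbT //; lia.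
  rewrite mulSn in le_kP *; move: (k * P)%N le_kP => x le_x; nia.
have [G0|G_gt0] := posnP G.
  have [-> //|K_gt0] := posnP K.
  have -> : P = 0%N by move: le_G; rewrite G0; nia.
  by rewrite G0 exp0n.
rewrite -(leq_pmul2r G_gt0) -mulnA -expnSr.
apply: (@leq_trans ((G + P) ^ K * (2 * (G - K * P)))%N).
  by rewrite leq_mul2l; apply/orP; right; lia.
by rewrite mulnCA leq_mul2l step.
Qed.

Definition array n m := {ffun 'I_m -> point n}.

Section Counting.
Variables (p n : nat).
Hypotheses (p_pr : prime p) (p_odd : odd p).

Definition zeros (q : quadric 'F_p n) := [set x | qeval q x == 0].

Definition vanishes m (q : quadric 'F_p n) (M : array n m) :=
  [forall j, M j \in zeros q].

Definition degenerate m : {set array n m} :=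
  [set M | [exists q, (q != [ffun=> 0]) && vanishes q M]].

Lemma card_vanishes m (q : quadric 'F_p n) :
  #|[set M : array n m | vanishes q M]| = (#|zeros q| ^ m)%N.
Proof.
rewrite -[X in (_ ^ X)%N]card_ord -card_ffun_on cardsE; apply: eq_card => M.
by rewrite !inE; apply/forallP/ffun_onP.
Qed.

(** Double counting of the pairs (q, M) with q vanishing on M: a quadric that
    vanishes on M brings its p - 1 nonzero multiples. *)
Lemma card_degenerate m :
  (p.-1 * #|degenerate m| <= \sum_(q | q != [ffun=> 0%R]) #|zeros q| ^ m)%N.
Proof.
under eq_bigr do rewrite -card_vanishes -sum1dep_card big_mkcond /=.
rewrite exchange_big /= mulnC -sum_nat_const.
rewrite big_mkcond /=; apply: leq_sum => M _.
rewrite inE; case: existsP => [[q /andP[q_neq0 qM]]|_]; last by [].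
rewrite -big_mkcondr sum1dep_card.
have [e qe_neq0] : exists e, q e != 0.
  apply/existsP; rewrite -negb_forall; apply: contra q_neq0 => /forallP q0.
  by apply/eqP/ffunP => e; rewrite ffunE; apply/eqP/q0.
have inj : injective (fun a => scale a q).
  by move=> a b /ffunP/(_ e); rewrite !ffunE; apply: mulIf.
apply: (@leq_trans #|(fun a => scale a q) @: [set a : 'F_p | a != 0%R]|).
  rewrite card_imset // -[X in (X.-1 <= _)%N](card_Fp p_pr).
  by rewrite (cardD1 0%R) inE /= leq_eqVlt; apply/orP; left; apply/eqP;
     apply: eq_card => a; rewrite !inE andbT.
apply/subset_leq_card/fintype.subsetP => _ /imsetP[a a_neq0 ->]; rewrite !inE in a_neq0 *.
apply/andP; split.
  apply: contraNneq a_neq0 => /ffunP/(_ e)/eqP.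
  by rewrite !ffunE mulf_eq0 (negPf qe_neq0) orbF.
apply/forallP => j; rewrite inE qeval_scale.
by move/forallP/(_ j): qM; rewrite inE => /eqP->; rewrite mulr0.
Qed.

Let N := (1 + 'C(n, 2))%N.

Lemma card_quadric : #|{: quadric 'F_p n}| = (p ^ N)%N.
Proof. by rewrite card_ffun card_option card_edge card_Fp. Qed.

(** The constant 3/4 is attained by 1 + x_1 x_2 + x_1 x_3 + x_2 x_3. *)
Lemma zeros_le (q : quadric 'F_p n) :
  q != [ffun=> 0] -> (4 * #|zeros q| <= 3 * 2 ^ n)%N.
Proof.
move=> q_neq0; have := card_nonzero (Fp_two_neq0 p_pr p_odd) q_neq0.
have := cardsC (zeros q); rewrite card_point.
have -> : ~: zeros q = [set x | qeval q x != 0] by apply/finset.setP => x; rewrite !inE.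
by move: #|_| #|_| => a b; lia.
Qed.

Variables (l r : nat).

(** The quadrics for which no bipartition by a binary digit gives
    equidistribution. *)
Definition low_rank : {set quadric 'F_p n} :=
  [set q | [forall t : 'I_l, \rank (cut_mx (digit t) q) <= r]%N].

(** A quadric is determined by its constant term and its cuts, which here are
    l matrices of rank at most r. *)
Lemma card_low_rank : (n <= 2 ^ l)%N ->
  (#|low_rank| <= p ^ (1 + 2 * n * r * l))%N.
Proof.
move=> le_n.
pose g (q : quadric 'F_p n) : 'F_p * {ffun 'I_l -> 'M['F_p]_n} :=
  (q None, [ffun t : 'I_l => cut_mx (digit t) q]).
have g_inj : injective g.
  move=> q q' /pair_eqP/andP[/eqP eqN /eqP/ffunP eq_cut].
  apply: (cut_mx_digit_inj le_n eqN) => t lt_tl.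
  by have := eq_cut (Ordinal lt_tl); rewrite !ffunE.
rewrite -(card_imset _ g_inj).
pose S := [set M : 'M['F_p]_n | (\rank M <= r)%N].
apply: (@leq_trans #|finset.setX [set: 'F_p]
    [set f : {ffun 'I_l -> 'M['F_p]_n} | f \in ffun_on (mem S)]|).
  apply/subset_leq_card/fintype.subsetP => _ /imsetP[q + ->]; rewrite inE => /forallP rk_q.
  by rewrite !inE /=; apply/ffun_onP => t; rewrite ffunE inE.
rewrite cardsX cardsT card_Fp // cardsE card_ffun_on card_ord expnS leq_mul2l.
rewrite expnM; apply/orP; right.
have := card_rank_le 'F_p n r; rewrite card_Fp // -/S => le_S.
by have [->|l_gt0] := posnP l; rewrite ?expn0 // leq_exp2r.
Qed.

Variables (g s : nat).
Hypotheses (n_gt0 : (0 < n)%N) (le_nl : (n <= 2 ^ l)%N).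
Hypotheses (le_s : (8 * p ^ 2 * (2 * g + 1) <= s)%N).
Hypotheses (le_r : (l.+1 * s + (2 * g + 1) <= r)%N).

Lemma zeros_equidistributed q : q \notin low_rank ->
  (p * 2 ^ g * #|zeros q| <= 2 ^ n * (2 ^ g + p))%N.
Proof.
rewrite inE negb_forall => /existsP[t]; rewrite -ltnNge => lt_r.
have [w w_prim] := C_prim_root_exists (prime_gt0 p_pr).
apply: (equidistribution_in p_pr p_odd w_prim (I := digit t) n_gt0 le_nl le_s).
by apply: (leq_trans le_r); apply: ltnW.
Qed.

Hypothesis le_g : (2 * (N * p) <= 2 ^ g)%N.
Hypothesis le_pl : (p <= 2 ^ l)%N.
Hypothesis le_N : (3 * (l * (1 + 2 * n * r * l)) <= N)%N.

(** Quadrics of low rank are so few that the bound 3/4 on their zeros suffices: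
    their sum is at most 1.  For the p ^ N others, the relative error p / 2 ^ g
    of equidistribution compounds to a factor at most 2. *)
Lemma degenerate_le m : (N <= m)%N ->
  (p.-1 * #|degenerate m| <= 3 * (2 ^ n) ^ m)%N.
Proof.
move=> le_Nm; apply: (leq_trans (card_degenerate m)).
have p_gt1 := prime_gt1 p_pr.
have good_q q : q \notin low_rank -> (p ^ N * #|zeros q| ^ m <= 2 * (2 ^ n) ^ m)%N.
  move=> /zeros_equidistributed; set z := #|_| => le_z; set G := (2 ^ g)%N in le_z.
  have le_G : (2 * (N * p) <= G)%N := le_g.
  have G_gt0 : (0 < G)%N by rewrite expn_gt0.
  have G_gt1 : (1 < G)%N by apply: leq_trans le_G; rewrite /N add1n mulSn; lia.
  have pG_gt0 : (0 < (p * G) ^ m)%N by rewrite expn_gt0 muln_gt0 G_gt0 prime_gt0.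
  rewrite -(leq_pmul2l pG_gt0) mulnCA -expnMn.
  apply: (@leq_trans (p ^ N * (2 ^ n * (G + p)) ^ m))%N.
    rewrite leq_mul2l; apply/orP; right.
    by case: (m) => [|k]; rewrite ?expn0 // leq_exp2r.
  rewrite expnMn mulnCA [X in (_ <= X)%N]mulnC -[X in (_ <= X)%N]mulnA.
  rewrite [X in (_ <= X)%N]mulnCA leq_mul2l; apply/orP; right.
  have em x : (x ^ m = x ^ N * x ^ (m - N))%N by rewrite -expnD subnKC.
  rewrite !em mulnA [X in (_ <= X)%N]mulnA leq_mul //; last first.
    by case: (m - N)%N => [|k]; rewrite ?expn0 // leq_exp2r //; nia.
  by rewrite expnMn mulnCA leq_mul2l compound_le ?orbT.
have bad_q q : q != [ffun=> 0%R] ->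
    (p ^ (1 + 2 * n * r * l) * #|zeros q| ^ m <= (2 ^ n) ^ m)%N.
  move=> /zeros_le; set z := #|_|; set k := (1 + _)%N => le_z.
  have le_kN : (3 * (l * k) <= N)%N := le_N.
  have pow4_gt0 : (0 < 4 ^ m)%N by rewrite expn_gt0.
  rewrite -(leq_pmul2l pow4_gt0) mulnCA -expnMn.
  apply: (@leq_trans (p ^ k * (3 * 2 ^ n) ^ m))%N.
    by rewrite leq_mul2l; case: (m) => [|j]; rewrite ?expn0 ?orbT // leq_exp2r ?le_z ?orbT.
  rewrite expnMn mulnA leq_mul2r; apply/orP; right.
  have le_m : (3 * (l * k) <= m)%N by apply: leq_trans le_Nm.
  have em x : (x ^ m = x ^ (3 * (l * k)) * x ^ (m - 3 * (l * k)))%N.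
    by rewrite -expnD subnKC.
  rewrite !em mulnA leq_mul //; last first.
    by case: (m - _)%N => [|j]; rewrite ?expn0 // leq_exp2r.
  apply: (@leq_trans (2 ^ (l * k) * 3 ^ (3 * (l * k))))%N.
    by rewrite leq_mul // expnM leq_exp2r.
  (* 2 * 3 ^ 3 <= 4 ^ 3 *)
  rewrite (expnM 3) (expnM 4) -expnMn.
  by have [->|lk_gt0] := posnP (l * k); rewrite ?expn0 // leq_exp2r.
rewrite (bigID (mem low_rank)) /=.
have pN_gt0 : (0 < p ^ N)%N by rewrite expn_gt0 ltnW.
have pk_gt0 : (0 < p ^ (1 + 2 * n * r * l))%N by rewrite expn_gt0 ltnW.
rewrite -[3%N]/(1 + 2)%N mulnDl mul1n leq_add //.
  rewrite -(leq_pmul2l pk_gt0) big_distrr /=.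
  apply: (@leq_trans (\sum_(q in low_rank) (2 ^ n) ^ m))%N.
    rewrite big_mkcond [X in (_ <= X)%N]big_mkcond /=; apply: leq_sum => q _.
    case: ifP => // /andP[q_neq0 ->]; exact: bad_q.
  by rewrite sum_nat_const leq_mul2r card_low_rank ?orbT.
rewrite -(leq_pmul2l pN_gt0) big_distrr /=.
apply: (@leq_trans (\sum_(q : quadric 'F_p n) 2 * (2 ^ n) ^ m))%N.
  rewrite big_mkcond /=; apply: leq_sum => q _.
  case: ifP => // /andP[_ ]; exact: good_q.
by rewrite sum_nat_const card_quadric.
Qed.

End Counting.

(** * Choice of the prime *)

Section PrimeChoice.
Local Open Scope nat_scope.

Lemma sum_le_threshold L M : \sum_(1 <= i < M.+1) (i <= L) = minn M L.
Proof.
elim: M => [|M IHM]; first by rewrite big_geq // min0n.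
by rewrite big_nat_recr //= IHM; lia.
Qed.

(** Legendre's formula: each power p ^ i contributes 2k / p^i - 2 (k / p^i),
    with integer quotients, which is 0 or 1, and 0 once p ^ i > 2k. *)
Lemma logn_central_binomial p k : prime p ->
  logn p 'C(2 * k, k) <= trunc_log p (2 * k).
Proof.
move=> p_pr; have p_gt1 := prime_gt1 p_pr.
have bin_gt0 : 0 < 'C(2 * k, k) by rewrite bin_gt0 leq_pmull.
have logE : logn p 'C(2 * k, k) + (logn p k`! + logn p k`!) = logn p (2 * k)`!.
  rewrite -(bin_fact (leq_pmull k (isT : 0 < 2))) mul2n -addnn addnK.
  by rewrite !lognM ?muln_gt0 ?fact_gt0 // addnn -mul2n.
have factE : logn p k`! = \sum_(1 <= i < (2 * k).+1) k %/ p ^ i.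
  rewrite logn_fact // [RHS](big_cat_nat (n := k.+1)) ?ltnS ?leq_pmull //=.
  rewrite [X in _ + X]big1_seq ?addn0 // => i.
  rewrite mem_index_iota => /andP[_ /andP[lt_ki _]].
  by rewrite divn_small // (ltn_trans lt_ki) // ltn_expl.
suff le_sum : logn p (2 * k)`! <=
    trunc_log p (2 * k) + (logn p k`! + logn p k`!).
  by rewrite -(leq_add2r (logn p k`! + logn p k`!)) logE.
rewrite logn_fact // factE -big_split /=.
apply: (@leq_trans (\sum_(1 <= i < (2 * k).+1)
    ((i <= trunc_log p (2 * k)) + (k %/ p ^ i + k %/ p ^ i)))).
  rewrite big_nat [X in _ <= X]big_nat; apply: leq_sum => i /andP[i_gt0 _].
  have pi_gt0 : 0 < p ^ i by rewrite expn_gt0 ltnW.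
  have [_|lt_i] := leqP i (trunc_log p (2 * k)).
    move: (p ^ i) pi_gt0 => d d_gt0.
    have := divn_eq k d; have := ltn_pmod k d_gt0.
    move: (k %/ d) (k %% d) => a b lt_bd ->.
    rewrite mulnDr mulnA divnMDl // [2 * a]mulSn mul1n.
    have : 2 * b %/ d < 2 by rewrite ltn_divLR // ltn_pmul2l.
    by lia.
  rewrite divn_small //; apply: leq_trans (trunc_log_ltn (2 * k) p_gt1) _.
  by rewrite leq_exp2l.
rewrite big_split leq_add2r /=.
by rewrite sum_le_threshold geq_minr.
Qed.

Lemma central_binomial_ge k : 2 ^ k <= 'C(2 * k, k).
Proof.
elim: k => [|k IHk]; first by rewrite bin0.
have rec : 'C(2 * k.+1, k.+1) * k.+1 = 'C(2 * k, k) * (2 * (2 * k).+1).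
  have := mul_bin_diag (2 * k).+2 k; have := mul_bin_down (2 * k).+1 k.
  have -> : 2 * k.+1 = (2 * k).+2 by lia.
  have -> : (2 * k).+1 - k = k.+1 by lia.
  move=> /=.
  by move: 'C(_, _) 'C(_, _) 'C(_, _) => a b c; nia.
rewrite -(leq_pmul2r (ltn0Sn k)) rec expnS -mulnA mulnCA.
by rewrite leq_mul // leq_mul2l; lia.
Qed.

(** If all prime divisors of 'C(2k, k) were at most y, this number would be at
    most (2k) ^ y, being a product of at most y prime powers that do not exceed
    2k. *)
Lemma prime_between y k : 0 < k -> (2 * k) ^ y < 2 ^ k ->
  exists p, [/\ prime p, y < p & p <= 2 * k].
Proof.
move=> k_gt0 lt_yk; set c := 'C(2 * k, k).
have c_gt0 : 0 < c by rewrite bin_gt0 leq_pmull.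
have prime_le p : p \in primes c -> p <= 2 * k.
  rewrite mem_primes => /and3P[p_pr _]; rewrite -{1}[p]expn1 pfactor_dvdn //.
  move=> log_gt0; have := leq_trans log_gt0 (logn_central_binomial k p_pr).
  rewrite trunc_log_gt0 => /andP[_]; lia.
have [/hasP[p p_c lt_yp]|/hasPn no_large] := boolP (has (fun p => y < p) (primes c)).
  by exists p; split => //; [move: p_c; rewrite mem_primes => /and3P[] | apply: prime_le].
suff le_c : c <= (2 * k) ^ y.
  by have := leq_trans (central_binomial_ge k) le_c; rewrite leqNgt lt_yk.
have size_primes : size (primes c) <= y.
  rewrite -(size_iota 1 y); apply: uniq_leq_size (primes_uniq c) _ => p p_c.
  rewrite mem_iota add1n ltnS; have /= := no_large p p_c; rewrite -leqNgt => ->.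
  rewrite andbT.
  by move: p_c; rewrite mem_primes => /and3P[/prime_gt0].
apply: (@leq_trans ((2 * k) ^ size (primes c))); last by rewrite leq_pexp2l // muln_gt0.
rewrite {1}[c]prod_prime_decomp // prime_decompE big_map /=.
have le_factor p : p \in primes c -> p ^ logn p c <= 2 * k.
  rewrite mem_primes => /and3P[p_pr _ _].
  apply: leq_trans (trunc_logP (prime_gt1 p_pr) _); last by rewrite muln_gt0.
  by rewrite leq_exp2l ?prime_gt1 // logn_central_binomial.
elim: (primes c) le_factor => [|p s IHs] le_factor; first by rewrite big_nil.
rewrite big_cons /= expnS leq_mul ?le_factor ?mem_head // IHs // => q q_s.
by rewrite le_factor // inE q_s orbT.
Qed.

(** Up to constants, g = l, the sparsity threshold is s = l p^2 and the rank
    threshold is r = l^2 p^2.  The condition that binds is that the low-rank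
    quadrics be few, n r l^2 = O(n^2).  As the prime satisfies p <= 4 l y, this
    becomes l^6 y^2 = O(n). *)
Lemma exists_prime_degenerate_le n l y : 1 < n -> n <= 2 ^ l -> 1 < y ->
  (216 * l ^ 3 * y) ^ 2 <= n ->
  exists p, [/\ prime p, y < p & forall m, 1 + 'C(n, 2) <= m ->
     p.-1 * #|degenerate p n m| <= 3 * (2 ^ n) ^ m].
Proof.
move=> n_gt1 le_nl y_gt1 le_yn.
have l_gt0 : 0 < l by case: l le_nl {le_yn} => //; rewrite expn0; lia.
pose k := l * y + 1.
have ly_gt0 : 0 < l * y by rewrite muln_gt0 l_gt0 ltnW.
have le_ly : l * y <= l ^ 3 * y.
  by rewrite leq_mul2r expnS leq_pmulr ?orbT // expn_gt0 l_gt0.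
have le_sq : (l ^ 3 * y) * 216 ^ 2 <= n.
  apply: leq_trans le_yn; rewrite -[216 * _ * _]mulnA expnMn mulnC leq_mul2l /=.
  by rewrite -mulnn leq_pmulr // muln_gt0 expn_gt0 l_gt0 ltnW.
have le_2k : 2 * k <= n.
  apply: leq_trans le_sq; apply: (@leq_trans (l * y * 4)); first by rewrite /k; lia.
  by rewrite leq_mul.
have [||p [p_pr lt_yp le_p]] := @prime_between y k.
- by rewrite /k addn1.
- apply: (@leq_ltn_trans ((2 ^ l) ^ y)); first by rewrite leq_exp2r ?(leq_trans le_2k) // ltnW.
  by rewrite -expnM /k addn1 ltn_exp2l.
exists p; split=> // m le_m.
have p_odd : odd p by case: (even_prime p_pr) => // p2; lia.
have le_p4 : p <= 4 * (l * y) by apply: leq_trans le_p _; rewrite /k; lia.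
pose g := 3 * l; pose s := 8 * p ^ 2 * (2 * g + 1); pose r := l.+1 * s + (2 * g + 1).
have le_pn : p <= n by apply: leq_trans le_p _.
have binE : 2 * 'C(n, 2) = n * n.-1.
  by rewrite bin2 mul2n even_halfK // oddM; case: (n) n_gt1 => //= j _; rewrite andNb.
apply: (@degenerate_le p n p_pr p_odd l r g s) => //.
- exact: ltnW.
- apply: (@leq_trans (n ^ 3)); last first.
    by rewrite /g mulnC expnM leq_exp2r.
  by rewrite mulnA expnSr leq_mul // -mulnn; nia.
- exact: leq_trans le_nl.
(* The remaining goal is the bound on the number of low-rank quadrics.  It
   follows from s <= 8 * 16 * 7 l q2 and r <= 2 l s + 7 l, where q2 stands for
   (l y)^2; with W = l^4 q2 it reads 3 l + 6 * 1799 n W <= 1 + 'C(n, 2), and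
   216^2 W <= n. *)
pose q2 := (l * y) ^ 2.
have q2_gt0 : 0 < q2 by rewrite expn_gt0 ly_gt0.
have le_p2 : p ^ 2 <= 16 * q2 by rewrite /q2 -[16]/(4 ^ 2) -expnMn leq_exp2r.
have le_s : s <= 896 * (l * q2).
  apply: (@leq_trans (8 * (16 * q2) * (7 * l))); last by lia.
  by rewrite /s leq_mul ?leq_mul2l // /g; lia.
have le_r : r <= 1799 * (l * (l * q2)).
  apply: (@leq_trans (2 * l * (896 * (l * q2)) + 7 * l)).
    apply: leq_add; last by rewrite /g; lia.
    by apply: (@leq_mul l.+1 s (2 * l)) => //; lia.
  have : l <= l * (l * q2) by rewrite leq_pmulr // muln_gt0 l_gt0.
  by move: (l * (l * q2)) (mulnA l l q2) => w; lia.
have W_le : 216 ^ 2 * (l * (l * (l * (l * q2)))) <= n.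
  apply: leq_trans le_yn; rewrite /q2 !expnMn -!mulnA leq_mul2l /=.
  by rewrite !expnS !expn0 !muln1 !mulnA.
pose W := l * (l * (l * (l * q2))).
have {}W_le : 216 * 216 * W <= n by rewrite mulnn.
have le_lr : l * r * l <= 1799 * W.
  rewrite mulnAC; apply: (@leq_trans (l * l * (1799 * (l * (l * q2))))).
    by rewrite leq_mul.
  by rewrite /W; lia.
have le_lW : l <= W.
  by rewrite /W leq_pmulr //; do 3!rewrite muln_gt0 l_gt0 /=.
have n_sq : n * (216 * 216 * W) <= n * n by rewrite leq_mul.
have le_nr : n * (l * r * l) <= n * (1799 * W) by rewrite leq_mul.
have le_Wn : W <= n * W by rewrite leq_pmull // ltnW.
have n_pred : n * n.-1 + n = n * n by case: (n) n_gt1 => //= j _; rewrite [RHS]mulnS addnC.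
have n_half : 2 * n <= n * n by rewrite leq_mul2r n_gt1 orbT.
have -> : 3 * (l * (1 + 2 * n * r * l)) = 3 * l + 6 * (n * (l * r * l)) by lia.
clearbody W; rewrite mulnCA in n_sq; rewrite [n * (_ * W)]mulnCA in le_nr.
move: n_sq le_nr le_lW le_Wn n_pred n_half binE.
move: (n * W) (n * n) (n * n.-1) (n * (l * r * l)) 'C(n, 2).
by move=> a b c d e; lia.
Qed.

End PrimeChoice.

Local Open Scope classical_set_scope.
Local Open Scope ring_scope.

(** * General position of the rows *)

Definition monomial_mx (F : comPzRingType) n m (M : 'I_m -> point n) :
    'M[F]_(m, #|{: option (edge n)}|) :=
  \matrix_(j, k) monomial F (M j) (enum_val k).
Arguments monomial_mx F {n m} M.

Lemma monomial_mxE (F : comPzRingType) n m (M : 'I_m -> point n)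
    (c : 'cV[F]_#|{: option (edge n)}|) j :
  (monomial_mx F M *m c) j 0 = qeval [ffun e => c (enum_rank e) 0] (M j).
Proof.
rewrite !mxE /qeval [RHS](reindex (@enum_val _ predT)) /=; last first.
  by exists enum_rank => x _; rewrite ?enum_rankK ?enum_valK.
by apply: eq_bigr => k _; rewrite mxE ffunE enum_valK mulrC.
Qed.

Lemma monomial_mx_int (F : comPzRingType) n m (M : 'I_m -> point n) :
  monomial_mx F M = map_mx intr (monomial_mx int M).
Proof.
apply/matrixP => j k; rewrite !mxE; case: (enum_val k) => [e|] //=.
by rewrite rmorphM /sgn !rmorphXn /= !rmorphN1.
Qed.

Definition general_position (F : comPzRingType) n m (M : 'I_m -> point n) :=
  forall q : quadric F n, (forall j, qeval q (M j) = 0) -> q = [ffun=> 0].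
Arguments general_position F {n m} M.

(** The matrix of monomials at the given points has integer entries.  A maximal
    minor that does not vanish modulo p is a nonzero integer, hence it does not
    vanish in F either. *)
Lemma general_position_lift p (F : numFieldType) n m (M : 'I_m -> point n) :
  prime p -> general_position 'F_p M -> general_position F M.
Proof.
move=> p_pr gen_p.
have full : row_full (monomial_mx 'F_p M).
  rewrite /row_full -mxrank_tr; change (row_free (monomial_mx 'F_p M)^T).
  rewrite -kermx_eq0; apply/rowV0P => v /sub_kermxP vA.
  have Av : monomial_mx 'F_p M *m v^T = 0 by rewrite -[LHS]trmxK trmx_mul trmxK vA trmx0.
  have /ffunP q0 : [ffun e => v^T (enum_rank e) 0] = [ffun=> 0].
    by apply: gen_p => j; rewrite -monomial_mxE Av mxE.
  apply/rowP => k; have := q0 (enum_val k).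
  by rewrite !ffunE enum_valK !mxE.
pose f := fullrankfun full.
have unit_Z : \det (rowsub f (monomial_mx int M)) != 0.
  have := fullrowsub_unit full; rewrite -/f monomial_mx_int -map_mxsub unitmxE.
  rewrite det_map_mx; apply: contraTneq => ->; by rewrite rmorph0 unitr0.
have unit_F : rowsub f (monomial_mx F M) \in unitmx.
  rewrite monomial_mx_int -map_mxsub unitmxE det_map_mx unitfE.
  by rewrite intr_eq0.
move=> q q0; pose c : 'cV[F]_#|{: option (edge n)}| := \col_k q (enum_val k).
have qE : q = [ffun e => c (enum_rank e) 0].
  by apply/ffunP => e; rewrite ffunE mxE enum_rankK.
have Ac : monomial_mx F M *m c = 0.
  by apply/colP => j; rewrite monomial_mxE -qE q0 mxE.
have c0 : c = 0.
  apply: (can_inj (mulKmx unit_F)); rewrite mulmx0.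
  by rewrite mul_rowsub_mx Ac; apply/matrixP => i j; rewrite !mxE.
by rewrite qE c0; apply/ffunP => e; rewrite !ffunE mxE.
Qed.

(** On sign vectors the diagonal terms of x^T Y x add up to the constant \tr Y,
    so x^T Y x - t is a quadric. *)
Lemma general_position_form (F : fieldType) n m (M : 'I_m -> point n)
    (Y : 'M[F]_n) t :
  general_position F M ->
  (forall j, \sum_a \sum_b Y a b * (sgn F (M j a) * sgn F (M j b)) = t) ->
  \tr Y = t /\ forall a b, a != b -> Y a b + Y b a = 0.
Proof.
move=> gen formE.
pose q : quadric F n := [ffun e => if e is Some e then
  Y (val e).1 (val e).2 + Y (val e).2 (val e).1 else \tr Y - t].
have coefq a b : coef_mx q a b = if (a < b)%N then Y a b + Y b a else 0.
  rewrite mxE; case: insubP => [e /= lt_ab eq_e|/= /negPf-> //].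
  by rewrite /q ffunE /= eq_e lt_ab.
have q0 : q = [ffun=> 0].
  apply: gen => j; rewrite qevalE ffunE.
  suff -> : \sum_a \sum_b coef_mx q a b * (sgn F (M j a) * sgn F (M j b)) = t - \tr Y.
    by rewrite addrA subrK subrr.
  apply/eqP; rewrite eq_sym subr_eq -(formE j); apply/eqP.
  pose mon a b := sgn F (M j a) * sgn F (M j b).
  transitivity (
     \sum_(a < n) \sum_(b < n) (if (a < b)%N then Y a b else 0) * mon a b
   + \sum_(a < n) \sum_(b < n) (if (b < a)%N then Y a b else 0) * mon a b
   + \sum_(a < n) \sum_(b < n) (if a == b then Y a b else 0)).
    rewrite -!big_split; apply: eq_bigr => a _; rewrite -!big_split /=.
    apply: eq_bigr => b _; have [->|neq_ab] := eqVneq a b.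
      by rewrite ltnn !mul0r !add0r /sgn -expr2 sqrr_sign mulr1.
    rewrite addr0; move: neq_ab; rewrite -(inj_eq val_inj) neq_ltn.
    case: ltngtP => // _ _; by rewrite mul0r ?addr0 ?add0r.
  congr (_ + _).
    rewrite [X in _ + X]exchange_big -big_split; apply: eq_bigr => a _ /=.
    rewrite -big_split; apply: eq_bigr => b _ /=; rewrite coefq /mon.
    by case: ifP => _; ring.
  apply: eq_bigr => a _; rewrite (bigD1 a) //= eqxx big1 ?addr0 // => b.
  by rewrite eq_sym => /negPf->.
split.
  by move/ffunP/(_ None): q0; rewrite !ffunE => /eqP; rewrite subr_eq0 => /eqP.
have lt_case (a b : 'I_n) : (a < b)%N -> Y a b + Y b a = 0.
  by move=> lt_ab; have := coefq a b; rewrite lt_ab q0 !mxE => <-;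
     case: insub => // e; rewrite ffunE.
move=> a b; rewrite -(inj_eq val_inj) neq_ltn => /orP[/lt_case //|/lt_case].
by rewrite addrC.
Qed.

(** * Faces of the elliptope *)

Lemma quadratic_formE (R : comPzRingType) m (x s : 'cV[R]_m) :
  (x^T *m (s *m s^T) *m x) 0 0 = (s^T *m x) 0 0 ^+ 2.
Proof.
rewrite -!mulmxA mulmxA mxE big_ord1 -[x^T *m s]trmxK trmx_mul trmxK mxE.
by rewrite expr2.
Qed.

Lemma cVdot_eq0 (R : realDomainType) m (x : 'cV[R]_m) :
  (x^T *m x) 0 0 = 0 -> x = 0.
Proof.
rewrite mxE => x0; apply/colP => i; rewrite mxE.
have /eqP := x0; rewrite psumr_eq0 => [/allP/(_ i)|j _]; last by rewrite mxE -expr2 sqr_ge0.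
by rewrite mem_index_enum mxE -expr2 sqrf_eq0 => /(_ isT)/eqP.
Qed.

(** For y = H x, the form at y + t x is affine in t with slope 2 |y|^2, so it can
    stay nonnegative only if y = 0. *)
Lemma pos_semidef_kernel (R : realType) m (H : 'M[R]_m) (x : 'cV[R]_m) :
  pos_semidef H -> (x^T *m H *m x) 0 0 = 0 -> H *m x = 0.
Proof.
move=> [Hsym Hpos] Hx; set y := H *m x.
pose b : R := (y^T *m y) 0 0.
have b_ge0 : 0 <= b.
  by rewrite /b mxE sumr_ge0 // => i _; rewrite mxE -expr2 sqr_ge0.
have yHx : (y^T *m H *m x) 0 0 = b by rewrite -mulmxA.
have xHy : (x^T *m H *m y) 0 0 = b.
  by rewrite -[in LHS]Hsym -trmx_mul.
pose c : R := (y^T *m H *m y) 0 0.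
have line t : 0 <= c + 2%:R * t * b.
  have := Hpos (y + t *: x); rewrite [(_ + _)^T]linearD /= [(_ *: _)^T]linearZ /=.
  rewrite !mulmxDl !mulmxDr -!scalemxAl -!scalemxAr.
  have entry (A B : 'M[R]_1) : (A + B) 0 0 = A 0 0 + B 0 0 by rewrite mxE.
  have entryZ a (A : 'M[R]_1) : (a *: A) 0 0 = a * A 0 0 by rewrite mxE.
  rewrite !entry !entryZ Hx yHx xHy -/c => /le_trans; apply; lra.
apply: cVdot_eq0; rewrite -/b; apply/eqP; rewrite eq_le b_ge0 andbT leNgt; apply/negP => b_gt0.
have c_ge0 : 0 <= c by have := line 0; lra.
have t_eq : c + 2%:R * (- (c + 1) / (2%:R * b)) * b = -1.
  by field; rewrite gt_eqF.
by have := line (- (c + 1) / (2%:R * b)); rewrite t_eq; lra.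
Qed.

Lemma cut_hull_sub (R : realType) n m (s : 'I_n -> 'cV[R]_m) :
  (forall i, sign_vector (s i)) -> cut_hull s `<=` cut_polytope R m.
Proof.
move=> s_sign x [k [p [a [pA a0 a1 ->]]]]; exists k, p, a; split => // i.
by have [j _ <-] := pA i; exists (s j) => //; apply: s_sign.
Qed.

Lemma cut_polytope_sub (R : realType) m : cut_polytope R m `<=` elliptope R m.
Proof.
move=> x [k [p [a [pA a0 a1 ->]]]].
have {}pA i : exists2 s : 'cV[R]_m, sign_vector s & p i = s *m s^T.
  by have [s s_sign <-] := pA i; exists s.
split; first split.
- rewrite raddf_sum; apply: eq_bigr => i _; have [s _ ->] := pA i.
  by rewrite /= [LHS]linearZ /= trmx_mul trmxK.
- move=> y; rewrite mulmx_sumr mulmx_suml summxE sumr_ge0 // => i _.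
  have [s _ ->] := pA i; rewrite -scalemxAr -scalemxAl mxE.
  by rewrite mulr_ge0 // quadratic_formE; apply: sqr_ge0.
- move=> j; rewrite summxE -[RHS]a1; apply: eq_bigr => i _.
  have [s s_sign ->] := pA i; rewrite !mxE big_ord1 mxE.
  by case: (s_sign j) => ->; rewrite ?mulrNN !mulr1.
Qed.

(** For positive semidefinite H this functional is nonnegative, and it vanishes
    exactly when H K = 0.  With K spanning the orthogonal complement of the
    column space of S, it exposes the face of the matrices with range in that
    space. *)
Definition compress (R : realType) m (K H : 'M[R]_m) : R := \tr (K^T *m H *m K).

Fact compress_is_linear (R : realType) m (K : 'M[R]_m) :
  linear_for *%R (compress K).
Proof.
by move=> a x y; rewrite /compress mulmxDr mulmxDl mxtraceD -scalemxAr -scalemxAl mxtraceZ.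
Qed.
HB.instance Definition _ (R : realType) m (K : 'M[R]_m) :=
  GRing.isLinear.Build R 'M[R]_m R *%R (compress K) (compress_is_linear K).

Lemma compressE (R : realType) m (K H : 'M[R]_m) :
  compress K H = \sum_i ((col i K)^T *m H *m col i K) 0 0.
Proof.
apply: eq_bigr => i _; rewrite !mxE; apply: eq_bigr => j _; rewrite !mxE.
congr (_ * _); apply: eq_bigr => k _; by rewrite !mxE.
Qed.

Lemma compress_ge0 (R : realType) m (K H : 'M[R]_m) :
  pos_semidef H -> 0 <= compress K H.
Proof. by move=> [_ Hpos]; rewrite compressE sumr_ge0. Qed.

Lemma compress_eq0 (R : realType) m (K H : 'M[R]_m) :
  pos_semidef H -> compress K H = 0 -> H *m K = 0.
Proof.
move=> Hpsd /eqP; rewrite compressE psumr_eq0 => [/allP K0|i _]; last exact: Hpsd.2.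
apply/matrixP => j i; rewrite [RHS]mxE.
have -> : (H *m K) j i = (H *m col i K) j 0.
  by rewrite !mxE; apply: eq_bigr => k _; rewrite mxE.
rewrite (pos_semidef_kernel Hpsd); first by rewrite mxE.
by have := K0 i; rewrite mem_index_enum => /(_ isT)/eqP.
Qed.

(** There are n'.+1 columns since an empty family of sign vectors spans no
    face. *)
Section GeneralPosition.
Variables (R : realType) (n' m : nat).
Let n := n'.+1.
Variables (M : 'I_m -> point n).
Hypothesis gen : general_position R M.

Definition column (i : 'I_n) : 'cV[R]_m := \col_j sgn R (M j i).

Let S : 'M[R]_(m, n) := \matrix_(j, i) sgn R (M j i).
Let P (i : 'I_n) : 'M[R]_m := column i *m (column i)^T.

Lemma column_sign i : sign_vector (column i).
Proof. by move=> j; rewrite mxE /sgn; case: (M j i); [right|left]. Qed.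

(** Multiplying a linear relation v^T x = 0 by the first coordinate turns it into
    x^T Y x = 0, where the first row of Y is v and the others are 0. *)
Lemma columns_free : row_free S^T.
Proof.
rewrite -kermx_eq0; apply/rowV0P => v /sub_kermxP vS.
have vM j : \sum_(i < n) v 0 i * sgn R (M j i) = 0.
  have /rowP/(_ j) := vS; rewrite !mxE => vSj; rewrite -[RHS]vSj.
  by apply: eq_bigr => i _; rewrite !mxE.
pose Y : 'M[R]_n := \matrix_(a, b) if a == 0 then v 0 b else 0.
have [|trY offY] := general_position_form (Y := Y) (t := 0) gen.
  move=> j; rewrite (bigD1 0) //= [X in _ + X]big1 ?addr0 => [|a a_neq0]; last first.
    by rewrite big1 // => b _; rewrite mxE (negPf a_neq0) mul0r.
  transitivity (sgn R (M j 0) * \sum_(i < n) v 0 i * sgn R (M j i)).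
    rewrite mulr_sumr.
    by apply: eq_bigr => b _; rewrite mxE eqxx mulrCA.
  by rewrite vM mulr0.
apply/rowP => b; rewrite mxE; have [->|b_neq0] := eqVneq b 0.
  move: trY; rewrite /mxtrace (bigD1 0) //= mxE eqxx big1 ?addr0 // => a a_neq0.
  by rewrite mxE (negPf a_neq0).
by have := offY 0 b; rewrite !mxE eqxx (negPf b_neq0) addr0 eq_sym => /(_ b_neq0).
Qed.

Lemma sum_rank_one (a : 'I_n -> R) :
  \sum_i a i *: P i = S *m diag_mx (\row_i a i) *m S^T.
Proof.
apply/matrixP => j k; rewrite summxE mxE; apply: eq_bigr => i _.
rewrite !mxE big_ord1 !mxE (bigD1 i) //= big1 ?addr0 => [|b b_neq]; last first.
  by rewrite !mxE (negPf b_neq) mulr0n mulr0.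
by rewrite !mxE eqxx mulr1n mulrA [_ * a i]mulrC.
Qed.

Lemma rank_one_free (a : 'I_n -> R) : \sum_i a i *: P i = 0 -> forall i, a i = 0.
Proof.
rewrite sum_rank_one => SaS; have /row_freeP[G SG] := columns_free.
have : G^T *m (S *m diag_mx (\row_i a i) *m S^T) *m G = 0 by rewrite SaS mulmx0 mul0mx.
rewrite -!mulmxA SG mulmx1 mulmxA -[G^T *m S]trmxK trmx_mul trmxK SG trmx1 mul1mx.
by move=> /matrixP a0 i; have := a0 i i; rewrite !mxE eqxx mulr1n.
Qed.

Lemma cut_hullP x : cut_hull column x <->
  exists a : 'I_n -> R, [/\ forall i, 0 <= a i, \sum_i a i = 1 & x = \sum_i a i *: P i].
Proof.
split=> [[k [p [a [pA a0 a1 ->]]]]|[a [a0 a1 ->]]]; last first.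
  by exists n, P, a; split => // i; exists i.
have /choice[f fP] : forall i, exists j, P j = p i.
  by move=> i; have [j _ <-] := pA i; exists j.
exists (fun j => \sum_(i | f i == j) a i); split.
- by move=> j; apply: sumr_ge0.
- by rewrite -[RHS]a1 [RHS](partition_big f xpredT).
- rewrite [LHS](partition_big f xpredT) //=; apply: eq_bigr => j _.
  by rewrite scaler_suml; apply: eq_bigr => i /eqP <-; rewrite fP.
Qed.

Lemma rank_one_in i : cut_hull column (P i).
Proof.
apply/cut_hullP; exists (fun j => (j == i)%:R); split=> [j||].
- by rewrite ler0n.
- by rewrite (bigD1 i) //= eqxx big1 ?addr0 // => j /negPf->.
- by rewrite (bigD1 i) //= eqxx scale1r big1 ?addr0 // => j /negPf->; rewrite scale0r.
Qed.

(** H = S Y S^T for a positive semidefinite Y, and the unit diagonal of H says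
    that x^T Y x = 1 at every row x of S; hence Y is diagonal of trace 1, and its
    diagonal entries are the weights. *)
Lemma ker_coker_cut_hull H : elliptope R m H -> H *m cokermx S^T = 0 -> cut_hull column H.
Proof.
move=> [[Hsym Hpos] Hdiag] HK.
have /submxP[D HD] : (H <= S^T)%MS by rewrite submxE HK.
have /row_freeP[G SG] := columns_free.
have GS : G^T *m S = 1%:M by rewrite -[LHS]trmxK trmx_mul trmxK SG trmx1.
pose Y := G^T *m H *m G.
have HY : H = S *m Y *m S^T.
  have DE : D = H *m G by rewrite HD -mulmxA SG mulmx1.
  have HDt : H = S *m D^T by rewrite -Hsym HD trmx_mul trmxK.
  rewrite {1}HD; congr (_ *m _); rewrite DE {1}HDt /Y -!mulmxA; congr (_ *m _).
  by rewrite mulmxA HDt [in RHS]mulmxA GS mul1mx.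
have Ysym : Y^T = Y by rewrite /Y !trmx_mul trmxK Hsym mulmxA.
have [|trY offY] := general_position_form (Y := Y) (t := 1) gen.
  move=> j; rewrite -(Hdiag j) HY !mxE exchange_big /=; apply: eq_bigr => b _.
  by rewrite !mxE mulr_suml; apply: eq_bigr => a _; rewrite !mxE; ring.
have Y_diag a b : a != b -> Y a b = 0.
  have Yba : Y b a = Y a b by rewrite -{1}Ysym mxE.
  by move=> /offY; rewrite Yba -mulr2n => /eqP; rewrite mulrn_eq0 => /eqP.
apply/cut_hullP; exists (fun i => Y i i); split.
- move=> i; suff -> : Y i i = ((col i G)^T *m H *m col i G) 0 0 by exact: Hpos.
  rewrite !mxE; apply: eq_bigr => j _; rewrite !mxE; congr (_ * _).
  by apply: eq_bigr => k _; rewrite !mxE.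
- exact: trY.
- rewrite sum_rank_one {1}HY; clearbody Y; congr (_ *m _ *m _).
  apply/matrixP => a b; rewrite !mxE.
  by have [->|neq_ab] := eqVneq a b; rewrite ?mulr1n // mulr0n Y_diag.
Qed.

Lemma cut_hull_ker H : cut_hull column H -> H *m cokermx S^T = 0.
Proof.
move=> /cut_hullP[a [_ _ ->]]; rewrite sum_rank_one -mulmxA.
by rewrite mulmx_coker mulmx0.
Qed.

Lemma cut_hull_exposed : exposed_face (elliptope R m) (cut_hull column).
Proof.
exists (compress (cokermx S^T)).
have sub_E x : cut_hull column x -> elliptope R m x.
  by move=> /(cut_hull_sub column_sign) /cut_polytope_sub.
have zero x : cut_hull column x -> compress (cokermx S^T) x = 0.
  by move=> /cut_hull_ker xK; rewrite /compress -mulmxA xK mulmx0 mxtrace0.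
apply/seteqP; split=> x /=.
  move=> Fx; split; first exact: sub_E.
  by move=> y [y_psd _]; rewrite zero // compress_ge0.
move=> [Ex x_min]; apply: ker_coker_cut_hull => //.
apply: compress_eq0; first exact: Ex.1.
apply/eqP; rewrite eq_le compress_ge0 ?andbT; last exact: Ex.1.
by rewrite -(zero _ (rank_one_in 0)) x_min //; apply/sub_E/rank_one_in.
Qed.

(** If x = sum_j a_j P_j has a weight a_i strictly between 0 and 1, then x lies
    strictly between P_i and the renormalised sum of the others, so an extreme
    point must equal P_i. *)
Lemma vertices_sub x : vertices (cut_hull column) x -> exists i, x = P i.
Proof.
move=> [Fx x_ext]; have /cut_hullP[a [a0 a1 xE]] := Fx.
have [i ai_gt0] : exists i, 0 < a i.
  apply/existsP; apply: contraT; rewrite negb_exists => /forallP a_le0.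
  have : \sum_i a i <= 0 by apply: sumr_le0 => i _; have := a_le0 i; rewrite -leNgt.
  by rewrite a1 ler10.
exists i; have rest : \sum_(j | j != i) a j = 1 - a i.
  by rewrite -a1 [X in _ = X - _](bigD1 i) //= addrAC subrr add0r.
have [ai_lt1|ai_ge1] := ltP (a i) 1; last first.
  have rest0 j : j != i -> a j = 0.
    have : \sum_(j | j != i) a j == 0.
      by rewrite eq_le sumr_ge0 // andbT rest subr_le0.
    by rewrite psumr_eq0 // => /allP/(_ j); rewrite mem_index_enum => /(_ isT)/implyP h /h/eqP.
  have ai1 : a i = 1.
    by move: rest; rewrite big1 // => /esym/eqP; rewrite subr_eq0 => /eqP.
  by rewrite xE (bigD1 i) //= ai1 scale1r big1 ?addr0 // => j /rest0->; rewrite scale0r.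
have c_gt0 : 0 < 1 - a i by rewrite subr_gt0.
pose y := \sum_j ((if j == i then 0 else a j) / (1 - a i)) *: P j.
have Fy : cut_hull column y.
  apply/cut_hullP; exists (fun j => (if j == i then 0 else a j) / (1 - a i)); split=> //.
    by move=> j; apply: divr_ge0; [case: ifP | apply: ltW].
  rewrite -mulr_suml (bigD1 i) //= eqxx add0r -[X in _ / X]rest.
  rewrite (eq_bigr a) => [|j /negPf-> //]; rewrite divff // rest gt_eqF //.
have [|-> //] := x_ext (P i) y (a i) (rank_one_in i) Fy ai_gt0 ai_lt1.
rewrite xE [LHS](bigD1 i) //=; congr (_ + _).
rewrite /y scaler_sumr [RHS](bigD1 i) //= eqxx mul0r scale0r scaler0 add0r.
by apply: eq_bigr => j /negPf->; rewrite scalerA mulrC divfK // gt_eqF.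
Qed.

Lemma cut_hull_simplicial : simplicial (cut_hull column).
Proof.
move=> k p a p_inj pV a0 ap0.
have /choice[f fP] : forall i, exists j, p i = P j by move=> i; apply: vertices_sub.
have f_inj : injective f by move=> i j eq_f; apply: p_inj; rewrite !fP eq_f.
have b0 := @rank_one_free (fun j => \sum_(i | f i == j) a i).
have sum0 : \sum_j (\sum_(i | f i == j) a i) *: P j = 0.
  rewrite -[RHS]ap0 [RHS](partition_big f xpredT) //=; apply: eq_bigr => j _.
  by rewrite scaler_suml; apply: eq_bigr => i /eqP <-; rewrite fP.
move=> i; have := b0 sum0 (f i); rewrite (bigD1 i) ?eqxx //= big1 ?addr0 // => j.
by rewrite (inj_eq f_inj) => /andP[/eqP->]; rewrite eqxx.
Qed.

Lemma cut_hull_dim : has_affine_dim (cut_hull column) n.-1.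
Proof.
split; first by exists (P 0); apply: rank_one_in.
pose X := [tuple P (lift ord0 i) - P 0 | i < n'].
exists <<X>>%VS; split.
- move=> x y /cut_hullP[a [_ a1 ->]] /cut_hullP[b [_ b1 ->]].
  have ab0 : \sum_(i < n) (a i - b i) = 0 by rewrite sumrB a1 b1 subrr.
  rewrite -sumrB.
  have -> : \sum_i (a i *: P i - b i *: P i) = \sum_i (a i - b i) *: (P i - P 0).
    under [RHS]eq_bigr do rewrite scalerBr.
    rewrite [RHS]sumrB -scaler_suml ab0 scale0r subr0.
    by apply: eq_bigr => i _; rewrite scalerBl.
  apply: rpred_sum => i _; apply: rpredZ.
  have [->|] := eqVneq i 0; first by rewrite subrr rpred0.
  rewrite eq_sym => /unlift_some[j -> _]; apply: memv_span.
  by apply/tnthP; exists j; rewrite tnth_mktuple.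
- move=> W FW; apply/span_subvP => _ /tnthP[j ->]; rewrite tnth_mktuple.
  by apply: FW; apply: rank_one_in.
- suff : free X by rewrite /free size_tuple => /eqP.
  apply/freeP => c c0 i.
  pose a (j : 'I_n) := if unlift ord0 j is Some j' then c j' else - \sum_i c i.
  have a0 := @rank_one_free a.
  have <- : a (lift ord0 i) = c i by rewrite /a liftK.
  apply: a0; rewrite big_ord_recl /a unlift_none -[RHS]c0.
  rewrite [X in _ + X](eq_bigr (fun j => c j *: P (lift ord0 j))) => [|j _]; last first.
    by rewrite liftK.
  under [RHS]eq_bigr do rewrite -tnth_nth tnth_mktuple scalerBr.
  by rewrite [RHS]sumrB -scaler_suml scaleNr addrC.
Qed.

Lemma general_position_face : spans_simplicial_face column.
Proof.
by split; [exact: cut_hull_exposed | exact: cut_hull_simplicial | exact: cut_hull_dim].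
Qed.

End GeneralPosition.

(** The functional that exposes the face in the elliptope exposes it in any
    convex set lying between the two. *)
Lemma face_of_cut_polytope (R : realType) n m (s : 'I_n -> 'cV[R]_m) :
  (forall i, sign_vector (s i)) -> spans_simplicial_face s ->
  exposed_face (cut_polytope R m) (cut_hull s).
Proof.
move=> s_sign [[f FE] _ [[z Fz] _]]; exists f.
have Fsub := cut_hull_sub s_sign.
apply/seteqP; split=> x /=.
  move=> Fx; split; first exact: Fsub.
  by move=> y /cut_polytope_sub Ey; move: Fx; rewrite FE => -[_]; apply.
move=> [Cx x_min]; rewrite FE; split; first exact: cut_polytope_sub.
move=> y Ey; apply: le_trans (x_min z (Fsub _ Fz)) _.
by move: Fz; rewrite FE => -[_]; apply.
Qed.

(** * Probability of general position *)

Lemma sgn_inj (F : numDomainType) : injective (sgn F).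
Proof.
have neq : (-1 == 1 :> F) = false by rewrite lt_eqF // (lt_trans (ltrN10 F)).
by move=> [] [] //; rewrite /sgn expr0 expr1 => /eqP; rewrite ?neq // eq_sym neq.
Qed.

Section Arrays.
Context d (T : measurableType d) (R : realType) (P : probability T R).
Variables (n' m : nat).
Let n := n'.+1.
Variable s : 'I_n -> T -> 'cV[R]_m.
Hypothesis s_iid : iid_uniform_signs P s.

(** An intersection over all indices, the form in which independence gives its
    probability. *)
Definition outcome (M : array n m) : set T :=
  \bigcap_(i in [set` [set: 'I_n]%SET]) (s i @^-1` [set column R M i]).

Lemma outcomeP M w : outcome M w <-> forall i, s i w = column R M i.
Proof.
split=> [Mw i|Mw i _]; last exact: Mw.
by apply: Mw; rewrite /= inE.
Qed.

Lemma measurable_outcome M : measurable (outcome M).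
Proof.
apply: fin_bigcap_measurable => [|i _]; first exact: finite_finset.
by case: s_iid.
Qed.

Lemma outcome_proba M : P (outcome M) = (2 ^- (n * m))%:E.
Proof.
have [_ _ unif indep] := s_iid.
rewrite /outcome (indep [set: 'I_n]%SET (fun i => [set column R M i])).
rewrite (eq_bigr (fun=> (2 ^- m : R)%:E)) => [|i _]; last first.
  by apply: unif; apply: column_sign.
rewrite (eq_bigl xpredT) => [|i]; last by rewrite inE.
by rewrite prodEFin prodr_const card_ord exprVn -exprM mulnC.
Qed.

Lemma outcome_inj M M' w : outcome M w -> outcome M' w -> M = M'.
Proof.
move=> /outcomeP Mw /outcomeP M'w; apply/ffunP => j; apply/ffunP => i.
have := Mw i; rewrite M'w => /colP/(_ j); rewrite !mxE => /esym.
exact: sgn_inj.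
Qed.

Lemma outcome_cover w : exists M, outcome M w.
Proof.
exists [ffun j => [ffun i => s i w j 0 == -1]]; apply/outcomeP => i.
have [s_sign _ _ _] := s_iid.
apply/colP => j; rewrite !mxE !ffunE /sgn; case: (s_sign i w j) => ->; last by rewrite eqxx.
have /negPf-> : (1 : R) != -1 by rewrite gt_eqF //; lra.
by [].
Qed.

Lemma face_event :
  [set w | spans_simplicial_face (fun i => s i w)] =
  \bigcup_(M in [set M : array n m | spans_simplicial_face (column R M)]) outcome M.
Proof.
apply/seteqP; split=> [w /= Fw|w [M FM /outcomeP Mw] /=].
  have [M Mw] := outcome_cover w; exists M => //=.
  have /outcomeP/funext sM := Mw; congr spans_simplicial_face: Fw; exact: sM.
have -> : (fun i => s i w) = column R M by apply/funext.
exact: FM.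
Qed.

(** The 2 ^ (n m) arrays are equally likely. *)
Lemma face_proba_ge (G : {set array n m}) :
  (forall M, M \in G -> spans_simplicial_face (column R M)) ->
  ((#|G|%:R / 2 ^+ (n * m))%:E <=
     P [set w | spans_simplicial_face (fun i => s i w)])%E.
Proof.
move=> G_face; pose U := \bigcup_(M in [set` enum G]) outcome M.
have PU : P U = (#|G|%:R / 2 ^+ (n * m))%:E.
  rewrite /U measure_fin_bigcup.
  - rewrite -fsbig_seq ?enum_uniq // (eq_bigr (fun=> (2 ^- (n * m) : R)%:E)) => [|M _].
      by rewrite sumEFin big_const_seq count_predT -cardE iter_addr addr0 mulr_natl.
    exact: outcome_proba.
  - exact: finite_seq.
  - move=> M M' _ _ [w [Mw M'w]]; exact: outcome_inj Mw M'w.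
  - by move=> M _; apply: measurable_outcome.
rewrite -PU face_event; apply: le_measure; rewrite ?inE.
- apply: fin_bigcup_measurable => [|M _]; [exact: finite_seq|exact: measurable_outcome].
- apply: fin_bigcup_measurable => [|M _]; [exact: finite_finset|exact: measurable_outcome].
- by move=> w [M /= MG Mw]; exists M => //=; apply: G_face; rewrite mem_enum in MG.
Qed.

End Arrays.

Lemma face_proba_of_prime d (T : measurableType d) (R : realType)
    (P : probability T R) n m p (s : 'I_n -> T -> 'cV[R]_m) :
  (0 < n)%N -> prime p -> (p.-1 * #|degenerate p n m| <= 3 * (2 ^ n) ^ m)%N ->
  iid_uniform_signs P s ->
  ((1 - 6 / p%:R)%:E <= P [set w | spans_simplicial_face (fun i => s i w)])%E.
Proof.
case: n s => // n' s _ p_pr le_deg s_iid.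
pose G := ~: degenerate p n'.+1 m.
have G_face M : M \in G -> spans_simplicial_face (column R M).
  rewrite !inE negb_exists => /forallP no_q; apply: general_position_face.
  apply: (general_position_lift p_pr) => q q0; apply/eqP; apply: contraT => q_neq0.
  have := no_q q; rewrite q_neq0 /= => /forallP[] j; rewrite inE q0 eqxx //.
apply: le_trans (face_proba_ge s_iid G_face); rewrite lee_fin.
have p_gt1 := prime_gt1 p_pr.
have N_gt0 : 0 < 2 ^+ (n'.+1 * m) :> R by rewrite exprn_gt0.
rewrite ler_pdivlMr //.
have cardG : #|G|%:R = 2 ^+ (n'.+1 * m) - #|degenerate p n'.+1 m|%:R :> R.
  apply/eqP; rewrite eq_sym subr_eq -natrD addnC cardsC card_ffun card_ord.
  by rewrite card_ffun card_bool card_ord -expnM natrX.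
rewrite cardG mulrBl mul1r lerD2l lerN2.
have pR_gt0 : 0 < p%:R :> R by rewrite ltr0n ltnW.
rewrite -mulrA [p%:R^-1 * _]mulrC mulrA ler_pdivlMr //.
have : p.-1%:R * #|degenerate p n'.+1 m|%:R <= 3 * 2 ^+ (n'.+1 * m) :> R.
  by rewrite -natrX -!natrM ler_nat expnM.
have : p%:R <= 2 * p.-1%:R :> R by rewrite -natrM ler_nat; lia.
have : 0 <= #|degenerate p n'.+1 m|%:R :> R by rewrite ler0n.
move: (#|_|%:R) (p%:R) (p.-1%:R) (2 ^+ _) => x a b N; nra.
Qed.

(** The integer part of sqrt n / a. *)
Lemma exists_square_cell a n : (0 < a)%N ->
  exists y, ((a * y) ^ 2 <= n < (a * y.+1) ^ 2)%N.
Proof.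
move=> a_gt0; pose Q z := (n < (a * z) ^ 2)%N.
have exQ : exists z, Q z by exists n.+1; rewrite /Q -mulnn; nia.
case: (ex_minnP exQ) => -[|y] Qy min_y; first by rewrite /Q muln0 in Qy.
exists y; apply/andP; split; last exact: Qy.
rewrite leqNgt; apply/negP => Qy'.
by have := min_y y Qy'; rewrite ltnn.
Qed.

Lemma bit_length_le_ln (R : realType) n : (1 < n)%N ->
  (up_log 2 n)%:R <= 2 / ln 2 * ln n%:R :> R.
Proof.
move=> n_gt1; have ln2_gt0 : 0 < ln 2 :> R by rewrite ln_gt0 // ltr1n.
have /andP[lt_n _] := up_log_bounds (isT : 1 < 2)%N n_gt1.
have l_gt0 : (0 < up_log 2 n)%N by rewrite up_log_gt0.
have ln2_le : ln 2 <= ln n%:R :> R by rewrite ler_ln ?posrE ?ltr0n ?ler_nat // ltnW.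
have pred_le : (up_log 2 n).-1%:R * ln 2 <= ln n%:R :> R.
  rewrite mulr_natl -lnXn // ler_ln ?posrE ?exprn_gt0 ?ltr0n //; last exact: ltnW.
  by rewrite -natrX ler_nat ltnW.
rewrite -mulrA [_^-1 * _]mulrC mulrA ler_pdivlMr // -(prednK l_gt0) -natr1.
by rewrite mulrDl mul1r; lra.
Qed.

Theorem theorem10p3 (R : realType) :
  (exists C2 C : R, [/\ 0 < C2, 0 < C &
     exists n0 : nat, forall n m : nat,
       (n0 <= n)%N -> (1 + 'C(n, 2) <= m)%N ->
       forall (d : measure_display) (T : measurableType d)
              (P : probability T R) (s : 'I_n -> T -> 'cV[R]_m),
         iid_uniform_signs P s ->
         ((1 - C2 * (ln n%:R `^ C / Num.sqrt n%:R))%:E <=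
            P [set w | spans_simplicial_face (fun i => s i w)])%E])
  /\
  (forall (n m : nat) (s : 'I_n -> 'cV[R]_m),
     (forall i, sign_vector (s i)) ->
     spans_simplicial_face s ->
     exposed_face (cut_polytope R m) (cut_hull s)).
Proof.
split; last by move=> n m s; apply: face_of_cut_polytope.
have ln2_gt0 : 0 < ln 2 :> R by rewrite ln_gt0 // ltr1n.
(* 1296 = 6 * 216: the failure probability is at most 6 / p, the prime satisfies
   sqrt n < 216 l^3 p, and the bit length l of n is at most (2 / ln 2) ln n. *)
exists (1296 * (2 / ln 2) ^+ 3), 3%:R; split.
- by rewrite mulr_gt0 ?exprn_gt0 ?divr_gt0 ?ltr0n.
- by rewrite ltr0n.
exists 2%N => n m n_gt1 le_m d T P s s_iid.
have lnn_ge0 : 0 <= ln n%:R :> R by rewrite ln_ge0 // ler1n ltnW.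
rewrite powR_mulrn //.
set l := up_log 2 n; have le_nl : (n <= 2 ^ l)%N.
  by have /andP[] := up_log_bounds (isT : 1 < 2)%N n_gt1.
have l_gt0 : (0 < l)%N by rewrite up_log_gt0.
have sqrt_gt0 : 0 < Num.sqrt n%:R :> R by rewrite sqrtr_gt0 ltr0n ltnW.
pose L : R := (2 / ln 2) ^+ 3 * ln n%:R ^+ 3.
have l3_le : (l ^ 3)%:R <= L.
  rewrite /L natrX -exprMn ler_pXn2r ?nnegrE ?mulr_ge0 ?ler0n ?invr_ge0 ?(ltW ln2_gt0) //.
  exact: bit_length_le_ln.
have sqrt_lt k : (n < k ^ 2)%N -> Num.sqrt n%:R <= k%:R :> R.
  move=> lt_nk; rewrite -[leRHS](ger0_norm (ler0n _ _)) -sqrtr_sqr.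
  by rewrite ler_wsqrtr // -natrX ler_nat ltnW.
have -> : 1296 * (2 / ln 2) ^+ 3 * (ln n%:R ^+ 3 / Num.sqrt n%:R) =
    1296 * L / Num.sqrt n%:R :> R by rewrite /L !mulrA.
have [|y /andP[le_yn lt_ny]] := @exists_square_cell (216 * l ^ 3) n.
  by rewrite muln_gt0 expn_gt0 l_gt0.
have [y_gt1|y_le1] := ltnP 1 y; last first.
  (* sqrt n < 432 l^3, so the claimed lower bound is negative *)
  apply: (@le_trans _ _ 0%E); last exact: measure_ge0.
  rewrite lee_fin subr_le0 ler_pdivlMr // mul1r.
  apply: (@le_trans _ _ (432 * (l ^ 3)%:R)); last by have := ler0n R (l ^ 3); lra.
  rewrite -natrM; apply: sqrt_lt; apply: (leq_trans lt_ny).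
  by rewrite leq_exp2r //; nia.
have [p [p_pr lt_yp deg_le]] := exists_prime_degenerate_le n_gt1 le_nl y_gt1 le_yn.
have n_gt0 := ltnW n_gt1.
apply: le_trans (face_proba_of_prime n_gt0 p_pr (deg_le m le_m) s_iid).
rewrite lee_fin lerD2l lerN2.
have p_gt0 : 0 < p%:R :> R by rewrite ltr0n prime_gt0.
rewrite ler_pdivrMr // mulrAC ler_pdivlMr //.
have sqrt_le : Num.sqrt n%:R <= 216 * (l ^ 3)%:R * p%:R :> R.
  rewrite -!natrM; apply: sqrt_lt; apply: (leq_trans lt_ny).
  by rewrite leq_exp2r // leq_mul.
apply: (@le_trans _ _ (6 * (216 * (l ^ 3)%:R * p%:R))); first by rewrite ler_pM2l.
apply: (@le_trans _ _ (1296 * (l ^ 3)%:R * p%:R)); first by lra.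
by rewrite ler_pM2r // ler_pM2l ?ltr0n.
Qed.
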